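(* Let $\Gamma$ be a connected Coxeter graph (with countable vertex set). Then the virtual Artin group $\mathrm{VA}[\Gamma]$ is indecomposable.
   Context: A Coxeter matrix on a countable (finite or infinite) set $S$ is a symmetric matrix $(m_{s,t})_{s,t\in S}$ with $m_{s,s}=1$ for all $s$ and $m_{s,t}\in\{2,3,4,\dots\}\cup\{\infty\}$ for $s\neq t$. It is encoded by the Coxeter graph $\Gamma$: the simplicial graph with vertex set $S$ in which distinct $s,t$ are joined by an edge iff $m_{s,t}\ge 3$, the edge being labeled by $m_{s,t}$ when $m_{s,t}\geq 4$ (including $\infty$). The virtual Artin group $\mathrm{VA}[\Gamma]$ is the group with generators $\{\sigma_s : s\in S\}\cup\{\tau_s : s\in S\}$ and relations: (VA1) $\cdots\sigma_s\sigma_t\sigma_s=\cdots\sigma_t\sigma_s\sigma_t$ (alternating words, both sides with $m_{s,t}$ letters, the left one ending in $\sigma_s$, the right one ending in $\sigma_t$) for all $s\ne t$ with $m_{s,t}\neq\infty$; (VA2) $\cdots\tau_s\tau_t\tau_s=\cdots\tau_t\tau_s\tau_t$ (both sides with $m_{s,t}$ letters) for all $s\neq t$ with $m_{s,t}\ne\infty$, and $\tau_s^2=\mathrm{id}$ for all $s\in S$; (VA3) for all $s\ne t$ with $m_{s,t}\neq\infty$, $P\,\sigma_t=\sigma_r\,P$, where $P=\cdots\tau_s\tau_t\tau_s$ is the alternating word in $\tau_s,\tau_t$ with $m_{s,t}-1$ letters ending in $\tau_s$, and $r=t$ if $m_{s,t}$ is even, $r=s$ if $m_{s,t}$ is odd.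 A group $G$ is decomposable if it is the (internal) direct product $G=H\times K$ of two proper subgroups $H,K$, and indecomposable otherwise. *)

(* Defs.v *)
From HB Require Import structures.
From mathcomp Require Import all_boot.
From mathcomp Require Import boolp.

Set Implicit Arguments.
Unset Strict Implicit.
Unset Printing Implicit Defensive.

Local Open Scope group_scope.
Local Open Scope quotient_scope.

(* A word is a list of signed generators: [(x, false)] stands for [x] and
   [(x, true)] for its inverse. *)
Definition word (X : Type) := seq (X * bool).

Definition gen (X : Type) (x : X) : word X := [:: (x, false)].

Definition inv_word (X : Type) (w : word X) : word X :=
  rev [seq (l.1, ~~ l.2) | l <- w].

Section Presentation.
Variables (X : choiceType) (R : word X -> word X -> Prop).

Inductive pres_eq : word X -> word X -> Prop :=
| pres_rel u v of R u v : pres_eq u v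
| pres_cancel x b : pres_eq [:: (x, b); (x, ~~ b)] [::]
| pres_refl u : pres_eq u u
| pres_sym u v of pres_eq u v : pres_eq v u
| pres_trans v u w of pres_eq u v & pres_eq v w : pres_eq u w
| pres_cat u u' v v' of pres_eq u u' & pres_eq v v' :
    pres_eq (u ++ v) (u' ++ v').

Definition pres_eqb : rel (word X) := fun u v => `[< pres_eq u v >].

Lemma pres_eqb_refl : reflexive pres_eqb.
Proof. by move=> u; apply/asboolP/pres_refl. Qed.

Lemma pres_eqb_sym : symmetric pres_eqb.
Proof. by move=> u v; apply/asboolP/asboolP; apply: pres_sym. Qed.

Lemma pres_eqb_trans : transitive pres_eqb.
Proof.
move=> v u w /asboolP uv /asboolP vw.
by apply/asboolP; apply: pres_trans uv vw.
Qed.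

Canonical pres_equiv : equiv_rel (word X) :=
  EquivRel pres_eqb pres_eqb_refl pres_eqb_sym pres_eqb_trans.

Definition presented_group : Type := {eq_quot pres_equiv}.
HB.instance Definition _ : EqQuotient _ pres_equiv presented_group :=
  EqQuotient.on presented_group.
HB.instance Definition _ := Choice.on presented_group.

Lemma presented_groupP u v : \pi_presented_group u = \pi_presented_group v <-> pres_eq u v.
Proof. by split=> [/eqmodP/asboolP|uv] //; apply/eqmodP/asboolP. Qed.

Definition pres_one : presented_group := \pi_presented_group [::].
Definition pres_mul (x y : presented_group) : presented_group :=
  \pi_presented_group (repr x ++ repr y).
Definition pres_inv (x : presented_group) : presented_group :=
  \pi_presented_group (inv_word (repr x)).

Lemma repr_presented u : pres_eq (repr (\pi_presented_group u)) u.
Proof. by apply/presented_groupP; rewrite reprK. Qed.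

Lemma pres_mulA : associative pres_mul.
Proof.
move=> x y z; apply/presented_groupP.
apply: (pres_trans (pres_cat (pres_refl _) (repr_presented _))).
rewrite catA; apply/pres_sym.
exact: pres_cat (repr_presented _) (pres_refl _).
Qed.

Lemma pres_mul1 : left_id pres_one pres_mul.
Proof.
move=> x; rewrite -[RHS]reprK; apply/presented_groupP.
exact: pres_cat (repr_presented [::]) (pres_refl _).
Qed.

Lemma pres_mulr1 : right_id pres_one pres_mul.
Proof.
move=> x; rewrite -[RHS]reprK; apply/presented_groupP.
rewrite -[X in pres_eq _ X]cats0.
exact: pres_cat (pres_refl _) (repr_presented [::]).
Qed.

Lemma inv_wordK : involutive (@inv_word X).
Proof.
move=> u; rewrite /inv_word map_rev revK -map_comp -[RHS]map_id.
by apply: eq_map => -[x b] /=; rewrite negbK.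
Qed.

Lemma inv_wordV u : pres_eq (u ++ inv_word u) [::].
Proof.
elim: u => [|[x b] u IHu]; first exact: pres_refl.
have -> : ((x, b) :: u) ++ inv_word ((x, b) :: u) =
    [:: (x, b)] ++ (u ++ inv_word u) ++ [:: (x, ~~ b)].
  by rewrite /inv_word /= rev_cons -cats1 catA.
apply: pres_trans (pres_cancel x b).
apply: (pres_cat (pres_refl [:: (x, b)])).
exact: pres_cat IHu (pres_refl _).
Qed.

Lemma pres_mulrV : right_inverse pres_one pres_inv pres_mul.
Proof.
move=> x; apply/presented_groupP; apply: pres_trans (inv_wordV (repr x)).
exact: pres_cat (pres_refl _) (repr_presented _).
Qed.

Lemma pres_mulV : left_inverse pres_one pres_inv pres_mul.
Proof.
move=> x; apply/presented_groupP; apply: pres_trans (inv_wordV (inv_word (repr x))).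
by rewrite inv_wordK; apply: pres_cat (repr_presented _) (pres_refl _).
Qed.

HB.instance Definition _ := isGroup.Build presented_group
  pres_mulA pres_mul1 pres_mulr1 pres_mulV pres_mulrV.

End Presentation.

(* [None] is the entry infinity. *)
Record coxeter_matrix (S : Type) := CoxeterMatrix {
  cox_m :> S -> S -> option nat;
  cox_sym : forall s t, cox_m s t = cox_m t s;
  cox_diag : forall s, cox_m s s = Some 1%N;
  cox_offdiag : forall s t k, s <> t -> cox_m s t = Some k -> (2 <= k)%N
}.

Definition coxeter_edge (S : eqType) (M : coxeter_matrix S) : rel S :=
  fun s t => (s != t) && (if M s t is Some k then (3 <= k)%N else true).

Definition coxeter_connected (S : eqType) (M : coxeter_matrix S) : Prop :=
  forall s t : S, exists2 p : seq S, path (coxeter_edge M) s p & last s p = t.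

(* [alternating k a b] is the alternating word ... a b a with [k] letters, the last
   one being [a]. *)
Fixpoint alternating (X : Type) (k : nat) (a b : X) : word X :=
  if k is k'.+1 then alternating k' b a ++ gen a else [::].

Section VirtualArtin.
Variables (S : choiceType) (M : coxeter_matrix S).

Definition sigma (s : S) : S + S := inl s.
Definition tau (s : S) : S + S := inr s.

Inductive va_rel : word (S + S) -> word (S + S) -> Prop :=
| VA1 s t m of s <> t & M s t = Some m :
    va_rel (alternating m (sigma s) (sigma t)) (alternating m (sigma t) (sigma s))
| VA2 s t m of s <> t & M s t = Some m :
    va_rel (alternating m (tau s) (tau t)) (alternating m (tau t) (tau s))
| VA2_inv s : va_rel (gen (tau s) ++ gen (tau s)) [::]
| VA3 s t m of s <> t & M s t = Some m :
    let P := alternating m.-1 (tau s) (tau t) in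
    let r := if odd m then s else t in
    va_rel (P ++ gen (sigma t)) (gen (sigma r) ++ P).

Definition virtual_artin : groupType := presented_group va_rel.

End VirtualArtin.

(* Subsets are boolean predicates; classically every subset is of this form. *)
Definition internal_direct_product (G : groupType) (H K : {pred G}) : Prop :=
  [/\ forall h k, h \in H -> k \in K -> commute h k,
      forall x, x \in H -> x \in K -> x = 1
    & forall x, exists h k, [/\ h \in H, k \in K & x = h * k]].

Definition proper_subgroup (G : groupType) (H : {pred G}) : Prop :=
  group_closed H /\ exists x : G, x \notin H.

Definition decomposable (G : groupType) : Prop :=
  exists H K : {pred G},
    [/\ proper_subgroup H, proper_subgroup K & internal_direct_product H K].

Definition indecomposable (G : groupType) : Prop := ~ decomposable G.

(* Main.v *)
From mathcomp Require Import Rstruct.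
From mathcomp Require Import all_boot.
From mathcomp Require Import all_order all_algebra.
From mathcomp Require Import boolp classical_sets reals trigo.
From mathcomp Require Import ring lra zify.
Require Import Defs.

(** Killing the sigma's maps G = VA[Gamma] onto the Coxeter group W of the tau's, and the
    kernel N is an Artin group generated by the conjugates of the sigma_s under W, indexed by
    the roots: two of them satisfy a braid relation exactly when the corresponding pair of roots
    is the image of a pair of simple roots. Hence a root and its opposite, as well as
    -alpha_s and alpha_t for an edge {s, t}, form a pair with label infinity.

    Every such pair {i, j} splits N as an amalgam of the parabolic subgroups omitting j,
    respectively i, over the one omitting both. Parabolic subgroups of N intersect well, because
    N retracts (as a set) onto each of them: a word is read through the minimal coset
    representatives of the Coxeter group of N. It follows that
    - a nontrivial subgroup of N that is normal in G lies in no proper parabolic subgroup, by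
      connectedness of Gamma;
    - two such subgroups do not commute, by comparing lengths of reduced words in an amalgam.
    So if G = H x K, one of H, K, say K, meets N trivially, whence K centralises N. If k in K
    maps to w in W, then the element k w^-1 of N permutes the simple roots of the Coxeter group of
    N up to sign, as w^-1 permutes their indices. A negative sign would give an infinite
    descent in an infinite dihedral subgroup, so k w^-1 acts trivially, w fixes
    all roots, w = 1, and k = 1. *)

Set Implicit Arguments.
Unset Strict Implicit.
Unset Printing Implicit Defensive.
Import Order.TTheory GRing.Theory Num.Theory.

(** * Chebyshev polynomials at [2 cos (pi / m)] *)

Section Chebyshev.
Local Open Scope ring_scope.
Variable R : realType.
Implicit Types (c t : R) (j k m : nat).

(** The pair is [(U_k, U_(k+1))] for the recurrence [U_(k+2) = c U_(k+1) - U_k]. At [c = 2 cos t]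
    this gives [U_k = sin (k t) / sin t]: Chebyshev polynomials of the second kind, shifted by one.
    They are the coefficients of the roots of a dihedral group. *)
Fixpoint cheb_pair c k : R * R :=
  if k is k'.+1 then let: (u, v) := cheb_pair c k' in (v, c * v - u) else (0, 1).

Definition cheb c k : R := (cheb_pair c k).1.

Lemma cheb0 c : cheb c 0 = 0. Proof. by []. Qed.

Lemma cheb1 c : cheb c 1 = 1. Proof. by []. Qed.

Lemma chebSS c k : cheb c k.+2 = c * cheb c k.+1 - cheb c k.
Proof. by rewrite /cheb /=; case: (cheb_pair c k). Qed.

(** The recurrence leaves the left side unchanged under [k -> k + 1], and at [k = 0] it is [U_j]. *)
Lemma cheb_wronskian c k j :
  cheb c k.+1 * cheb c (k + j) - cheb c k * cheb c (k + j).+1 = cheb c j.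
Proof.
elim: k => [|k IHk]; first by rewrite cheb0 cheb1 add0n mul0r subr0 mul1r.
by rewrite -[RHS]IHk !addSn !chebSS; ring.
Qed.

Lemma cheb_sin t k : sin t * cheb (2 * cos t) k = sin (t * k%:R).
Proof.
suff: sin t * cheb (2 * cos t) k = sin (t * k%:R) /\
      sin t * cheb (2 * cos t) k.+1 = sin (t * k.+1%:R) by case.
elim: k => [|k [IH0 IH1]].
  by rewrite cheb0 cheb1 !mulr0 !mulr1 sin0.
split=> //; rewrite chebSS mulrBr IH0 mulrCA IH1.
have -> : t * k.+2%:R = t * k.+1%:R + t by rewrite -[k.+2%:R]natr1 mulrDr mulr1.
have -> : t * k%:R = t * k.+1%:R - t by rewrite -[k.+1%:R]natr1 mulrDr mulr1 addrK.
by rewrite sinB sinD; ring.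
Qed.

Definition coxcos m : R := 2 * cos (pi / m%:R).

Lemma sin_angle_gt0 m k : (0 < k < m)%N -> 0 < sin (pi / m%:R * k%:R) :> R.
Proof.
move=> /andP[k0 km]; have m0 : (0 : R) < m%:R by rewrite ltr0n (ltn_trans k0 km).
apply: sin_gt0_pi; apply/andP; split.
  by rewrite mulr_gt0 ?divr_gt0 ?pi_gt0 ?(ltr0n _ k).
by rewrite mulrAC ltr_pdivrMr // ltr_pM2l ?pi_gt0 // ltr_nat.
Qed.

Lemma cheb_gt0 m k : (0 < k < m)%N -> 0 < cheb (coxcos m) k.
Proof.
move=> km; have m1 : (0 < 1 < m)%N by lia.
rewrite -(pmulr_rgt0 _ (sin_angle_gt0 m1)) mulr1.
by rewrite cheb_sin sin_angle_gt0.
Qed.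

Lemma cheb_order m : (1 < m)%N ->
  cheb (coxcos m) m = 0 /\ cheb (coxcos m) m.+1 = -1.
Proof.
move=> m1; have m1' : (0 < 1 < m)%N by lia.
have /[!mulr1] s0 := sin_angle_gt0 m1'.
have m0 : m%:R != 0 :> R by rewrite pnatr_eq0; lia.
split; apply: (mulfI (lt0r_neq0 s0)); rewrite cheb_sin.
  by rewrite divfK // sinpi mulr0.
by rewrite -natr1 mulrDr divfK // mulr1 addrC sinDpi mulrN1.
Qed.

(** The limit [t -> 0], which serves the label infinity. *)
Lemma cheb2 k : cheb 2 k = k%:R :> R.
Proof.
suff: cheb 2 k = k%:R :> R /\ cheb 2 k.+1 = k.+1%:R :> R by case.
elim: k => [|k [IH0 IH1]]; first by rewrite cheb0 cheb1.
by split=> //; rewrite chebSS IH0 IH1 -[k.+2%:R]natr1 -[k.+1%:R]natr1; ring.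
Qed.

Lemma cheb_sym m k : (1 < m)%N -> (k <= m)%N ->
  cheb (coxcos m) (m - k) = cheb (coxcos m) k.
Proof.
move=> m1 km; have [U0 U1] := cheb_order m1.
by rewrite -(cheb_wronskian _ k) subnKC // U0 U1; ring.
Qed.

Lemma coxcos_bounds m : (1 < m)%N -> 0 <= coxcos m < 2.
Proof.
move=> m1; have m0 : (0 : R) < m%:R by rewrite ltr0n; lia.
have le2 : pi / m%:R <= pi / 2 :> R.
  by rewrite ler_pM2l ?pi_gt0 // lef_pV2 ?posrE ?ler_nat.
have t0 : 0 < pi / m%:R :> R by rewrite divr_gt0 ?pi_gt0.
apply/andP; split.
  rewrite mulr_ge0 // cos_ge0_pihalf // le2 andbT.
  by rewrite (le_trans _ (ltW t0)) // oppr_le0 divr_ge0 ?pi_ge0.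
have le_pi : pi / m%:R <= pi :> R.
  by rewrite (le_trans le2) // ler_pdivrMr // ler_peMr ?pi_ge0 //; lra.
have : cos (pi / m%:R) < cos (0 : R).
  by rewrite ltr_cos // in_itv /= ?lexx ?pi_ge0 ?(ltW t0).
by rewrite cos0 /coxcos; lra.
Qed.

Lemma coxcos_gt0 m : (2 < m)%N -> 0 < coxcos m.
Proof.
move=> m2; have m0 : (0 : R) < m%:R by rewrite ltr0n; lia.
rewrite mulr_gt0 // cos_gt0_pihalf //; apply/andP; split.
  by rewrite (@lt_trans _ _ 0) ?divr_gt0 ?pi_gt0 // oppr_lt0 divr_gt0 ?pi_gt0.
by rewrite ltr_pM2l ?pi_gt0 // ltf_pV2 ?posrE ?ltr_nat.
Qed.

Lemma coxcos_inj m n : (0 < m)%N -> (0 < n)%N -> coxcos m = coxcos n -> m = n.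
Proof.
move=> m0 n0 /(mulfI (lt0r_neq0 (ltr0n _ 2))) E.
have in_pi k : (0 < k)%N -> pi / k%:R \in `[0, pi :> R].
  move=> k0; rewrite in_itv /= divr_ge0 ?pi_ge0 //=.
  by rewrite ler_pdivrMr ?ltr0n // ler_peMr ?pi_ge0 // ler1n.
have /(mulfI (lt0r_neq0 (pi_gt0 R)))/invr_inj/eqP := cos_inj (in_pi _ m0) (in_pi _ n0) E.
by rewrite eqr_nat => /eqP.
Qed.

Lemma coxcos1 : coxcos 1 = -2.
Proof. by rewrite /coxcos divr1 cospi mulrN1. Qed.

End Chebyshev.

(** * The geometric representation and its root dichotomy *)

Section GeometricRepresentation.
Local Open Scope ring_scope.
Variables (R : realType) (I : Type) (M : coxeter_matrix I).
Implicit Types (i j s t : I) (l : seq I) (f g : I -> R) (k m : nat).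

(** Twice the usual Tits form: simple roots get norm 2, and infinity the limit value -2. *)
Definition cox_angle (o : option nat) : R := if o is Some m then - coxcos R m else - 2.

Definition cox_form i j : R := cox_angle (M i j).

Lemma cox_formC i j : cox_form i j = cox_form j i.
Proof. by rewrite /cox_form cox_sym. Qed.

Lemma cox_form_diag i : cox_form i i = 2.
Proof. by rewrite /cox_form cox_diag /= coxcos1 opprK. Qed.

Lemma cox_formK i j m : M i j = Some m -> - cox_form i j = coxcos R m.
Proof. by rewrite /cox_form => -> /=; rewrite opprK. Qed.

(* The contragredient action: a vector [f] is a function on the simple roots, and the root
   [w^-1 alpha_i] is the functional [f |-> w f i]. *)
Definition reflect i f : I -> R := fun j => f j - cox_form i j * f i.

Definition cox_act l f : I -> R := foldr reflect f l.

(** The word starts with [x], whereas [alternating] ends with its first argument. Since [cox_act]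
    folds from the right, [x] acts last. *)
Fixpoint alt_seq (T : Type) k (x y : T) : seq T :=
  if k is k'.+1 then x :: alt_seq k' y x else [::].

Lemma size_alt_seq (T : Type) k (x y : T) : size (alt_seq k x y) = k.
Proof. by elim: k x y => //= k IHk x y; rewrite IHk. Qed.

Lemma alt_seqSr (T : Type) k (x y : T) :
  alt_seq k.+1 x y = rcons (alt_seq k x y) (if odd k then y else x).
Proof. by elim: k x y => //= k IHk x y; rewrite [in LHS]IHk /=; case: (odd k). Qed.

Lemma alt_seqD (T : Type) k1 k2 (x y : T) :
  alt_seq (k1 + k2) x y = alt_seq k1 x y ++
    (if odd k1 then alt_seq k2 y x else alt_seq k2 x y).
Proof. by elim: k1 x y => //= k IHk x y; rewrite IHk; case: (odd k). Qed.

Lemma rev_alt_seq (T : Type) k (x y : T) :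
  rev (alt_seq k x y) = if odd k then alt_seq k x y else alt_seq k y x.
Proof.
elim: k x y => //= k IHk x y; rewrite rev_cons IHk.
have /= E1 := alt_seqSr k y x; have /= E2 := alt_seqSr k x y.
by case: (odd k) E1 E2 => /= E1 E2; rewrite ?E1 ?E2.
Qed.

(** Equality in the Coxeter group, kept at the level of words so that length and reducedness need no
    quotient. *)
Inductive cox_eq : seq I -> seq I -> Prop :=
| cox_eq_inv i : cox_eq [:: i; i] [::]
| cox_eq_braid i j m of i <> j & M i j = Some m :
    cox_eq (alt_seq m i j) (alt_seq m j i)
| cox_eq_refl l : cox_eq l l
| cox_eq_sym l l' of cox_eq l l' : cox_eq l' l
| cox_eq_trans l l' l'' of cox_eq l l' & cox_eq l' l'' : cox_eq l l''
| cox_eq_cat l1 l1' l2 l2' of cox_eq l1 l1' & cox_eq l2 l2' :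
    cox_eq (l1 ++ l2) (l1' ++ l2').

Lemma cox_act_cat l l' f : cox_act (l ++ l') f = cox_act l (cox_act l' f).
Proof. exact: foldr_cat. Qed.

Lemma reflectK i : involutive (reflect i).
Proof.
by move=> f; apply/funext => j; rewrite /reflect cox_form_diag; ring.
Qed.

Lemma reflect_diag i f : reflect i f i = - f i.
Proof. by rewrite /reflect cox_form_diag; ring. Qed.

(** Powers of the rank-two rotation in closed form, for finite labels and infinity alike. The term
    [c U_k - U_(k+1)] stands for [U_(k-1)] and avoids a predecessor at [k = 0]. *)
Lemma cox_act_alt k i j f : let c := - cox_form i j in
  cox_act (alt_seq k i j) f j =
    cheb c k.+1 * f (if odd k then i else j) + cheb c k * f (if odd k then j else i) /\
  cox_act (alt_seq k i j) f i =
    - (cheb c k * f (if odd k then i else j) +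
       (c * cheb c k - cheb c k.+1) * f (if odd k then j else i)).
Proof.
move=> c; elim: k i j @c => [|k IHk] i j c /=.
  by rewrite cheb0 cheb1; split; ring.
have [] := IHk j i; rewrite cox_formC -/c.
set g := cox_act _ f; have -> : reflect i g i = - g i by exact: reflect_diag.
have -> : reflect i g j = g j + c * g i by rewrite /reflect /c; ring.
move=> -> ->; rewrite !chebSS.
by case: (odd k) => /=; split; ring.
Qed.

Lemma reflectD i (u v : R) f g :
  reflect i (fun j => u * f j + v * g j) = fun j => u * reflect i f j + v * reflect i g j.
Proof. by apply/funext => j; rewrite /reflect; ring. Qed.

Lemma cox_actD l (u v : R) f g :
  cox_act l (fun j => u * f j + v * g j) = fun j => u * cox_act l f j + v * cox_act l g j.
Proof. by elim: l => //= i l ->; rewrite reflectD. Qed.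

Lemma cox_act_alt_span k i j f :
  exists u v, forall x, cox_act (alt_seq k i j) f x = f x + u * cox_form i x + v * cox_form j x.
Proof.
elim: k i j => [|k IHk] i j /=; first by exists 0, 0 => x; ring.
have [u [v E]] := IHk j i; exists (v - cox_act (alt_seq k j i) f i), u => x.
by rewrite /reflect E; ring.
Qed.

(** Both sides differ from [f] by combinations of the form rows of [i] and [j], and by the closed
    formula they agree at [i] and [j]. The coefficients then coincide, because the Gram determinant
    [4 - c^2] is nonzero for a finite label. *)
Lemma cox_act_braid i j m f : i <> j -> M i j = Some m ->
  cox_act (alt_seq m i j) f = cox_act (alt_seq m j i) f.
Proof.
move=> ij Mij; have m1 := cox_offdiag ij Mij.
have [u1 [v1 E1]] := cox_act_alt_span m i j f.
have [u2 [v2 E2]] := cox_act_alt_span m j i f.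
have cE := cox_formK Mij; set c := coxcos R m in cE.
have cE' : cox_form i j = - c by rewrite -cE opprK.
have [U0 U1] := cheb_order R m1.
have := cox_act_alt m i j f; have := cox_act_alt m j i f.
rewrite /= [cox_form j i]cox_formC cE U0 U1 => -[].
rewrite !E1 !E2 !cox_form_diag [cox_form j i]cox_formC cE'.
move=> A1 A2 [A3 A4].
have /andP[c0 c2] : 0 <= c < 2 by exact: coxcos_bounds.
have [Ei Ej] : 2 * (u1 - v2) = c * (v1 - u2) /\ 2 * (v1 - u2) = c * (u1 - v2).
  by split; case: (odd m) A1 A2 A3 A4; lra.
have Zu : u1 - v2 = 0.
  have : (4 - c * c) * (u1 - v2) = 0 by nra.
  by move/eqP; rewrite mulf_eq0 => /orP[/eqP|/eqP //]; nra.
have Zv : v1 - u2 = 0 by rewrite Zu in Ej; lra.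
apply/funext => x; rewrite E1 E2.
have -> : u1 = v2 by lra.
have -> : v1 = u2 by lra.
by ring.
Qed.

Lemma cox_act_eq l l' f : cox_eq l l' -> cox_act l f = cox_act l' f.
Proof.
move=> e; elim: e f => {l l'} //.
- by move=> i f; rewrite /= reflectK.
- by move=> i j m ij Mij f; apply: cox_act_braid.
- by move=> l l' l'' _ IH1 _ IH2 f; rewrite IH1 IH2.
- by move=> l1 l1' l2 l2' _ IH1 _ IH2 f; rewrite !cox_act_cat IH2 IH1.
Qed.

Lemma cox_eq_cons2 l i : cox_eq (i :: i :: l) l.
Proof. exact: (cox_eq_cat (cox_eq_inv i) (cox_eq_refl l)). Qed.

Lemma cox_eq_consl l l' i : cox_eq l l' -> cox_eq (i :: l) (i :: l').
Proof. by move=> e; exact: (cox_eq_cat (cox_eq_refl [:: i]) e). Qed.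

Lemma cox_actK l f : cox_act (rev l) (cox_act l f) = f.
Proof.
elim: l f => //= i l IHl f; rewrite rev_cons -cats1 cox_act_cat /= reflectK.
exact: IHl.
Qed.

Lemma cox_actVK l f : cox_act l (cox_act (rev l) f) = f.
Proof. by rewrite -{1}[l]revK cox_actK. Qed.

(** * Positive and negative roots, reduced words *)

Definition nonneg f := forall i, 0 <= f i.

(** A root is the functional [f -> cox_act l f s]. Testing it on nonnegative [f] expresses the sign
    of its coefficients without naming them. *)
Definition pos_root l s := forall f, nonneg f -> 0 <= cox_act l f s.
Definition neg_root l s := forall f, nonneg f -> cox_act l f s <= 0.

Definition reduced l := forall l', cox_eq l l' -> (size l <= size l')%N.

Lemma reduced_ex l : exists2 l', cox_eq l l' & reduced l'.
Proof.
have [n le_n] := ubnP (size l); elim: n l le_n => // n IHn l le_n.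
have [red|] := pselect (reduced l); first by exists l => //; exact: cox_eq_refl.
move=> /existsNP[l1 /not_implyP[e /negP]]; rewrite -ltnNge => lt.
have [|l2 e2 red2] := IHn l1; first by lia.
by exists l2 => //; exact: cox_eq_trans e e2.
Qed.

Definition le_order k (o : option nat) : bool := if o is Some m then (k <= m)%N else true.

Lemma cheb_ge0 i j k : i <> j -> le_order k (M i j) ->
  0 <= cheb (- cox_form i j) k.
Proof.
move=> ij; rewrite /cox_form /le_order; case E: (M i j) => [m|] /=; rewrite opprK.
  move=> km; have m1 := cox_offdiag ij E.
  case: (posnP k) => [->//|k0]; case: (ltnP k m) => [lt|ge].
    by apply/ltW/cheb_gt0; rewrite k0.
  have -> : k = m by lia.
  by have [-> _] := cheb_order R m1.
by rewrite cheb2 => _; exact: ler0n.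
Qed.

(* Strip from [t :: l1] the longest alternating prefix in [s] and [t]: on the remaining word both
   [s] and [t] are positive, and the prefix acts through Chebyshev coefficients. *)
Lemma tits_dichotomy l s : reduced l ->
  pos_root l s \/
  (neg_root l s /\ exists2 l', cox_eq (s :: l) l' & (size l' < size l)%N).
Proof.
have [n le_n] := ubnP (size l); elim: n l s le_n => // n IHn l s le_n red.
case: l le_n red => [|t l1] le_n red; first by left=> f; exact.
have red_tail (d l2 : seq I) : cox_eq (t :: l1) (d ++ l2) ->
    (size d + size l2 <= (size l1).+1)%N -> reduced l2.
  move=> e le l3 e3; have := red _ (cox_eq_trans e (cox_eq_cat (cox_eq_refl d) e3)).
  by rewrite /= size_cat; lia.
have red1 : reduced l1 by apply: (red_tail [:: t]) => //; exact: cox_eq_refl.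
have [st|st] := pselect (s = t).
  rewrite {}st in red le_n *.
  have [|pos|[_ [l' e lt]]] := IHn l1 t _ red1; first by rewrite /= in le_n; lia.
    right; split; last by exists l1 => //; exact: cox_eq_cons2.
    by move=> f f0; rewrite /= reflect_diag oppr_le0 pos.
  by have := red _ e; rewrite /=; lia.
(* Minimising the length [p] of the remaining word [l2] makes the alternating prefix as long as
   possible. *)
pose Q p := exists k a b l2, [/\ (a = s /\ b = t) \/ (a = t /\ b = s), (0 < k)%N,
   cox_eq (t :: l1) (alt_seq k a b ++ l2), (k + size l2 = (size l1).+1)%N & size l2 = p].
have exQ : exists p, `[< Q p >].
  exists (size l1); apply/asboolP; exists 1%N, t, s, l1.
  by split=> //; [right|exact: cox_eq_refl].
have [p /asboolP[k [a [b [l2 [ab k0 e sz szp]]]]] minp] := ex_minnP exQ.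
have red2 : reduced l2 by apply: (red_tail _ _ e); rewrite size_alt_seq sz.
have lt2 : (size l2 < n)%N by rewrite /= in le_n; lia.
pose x := if odd k then a else b; pose y := if odd k then b else a.
have altk : alt_seq k a b = rcons (alt_seq k.-1 a b) x.
  by rewrite /x; case: (k) k0 => // k' _; rewrite alt_seqSr /=; case: (odd k').
(* [x] is the last letter of the prefix, so a descent of [l2] at [x] would shorten the whole
   word. *)
have posx : pos_root l2 x.
  have [//|[_ [l3 e3 lt3]]] := IHn _ x lt2 red2.
  have : cox_eq (t :: l1) (alt_seq k.-1 a b ++ l3).
    apply: cox_eq_trans e _; rewrite altk cat_rcons.
    by apply: cox_eq_cat e3; exact: cox_eq_refl.
  by move/red; rewrite /= size_cat size_alt_seq; lia.
(* [y] is the letter that would continue the prefix, so a descent of [l2] at [y] would contradict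
   the minimality of [p]. *)
have posy : pos_root l2 y.
  have [//|[_ [l3 e3 lt3]]] := IHn _ y lt2 red2.
  have e4 : cox_eq (t :: l1) (alt_seq k.+1 a b ++ l3).
    apply: cox_eq_trans e _; rewrite alt_seqSr -/y cat_rcons.
    apply: cox_eq_cat; first exact: cox_eq_refl.
    by apply: cox_eq_trans (cox_eq_sym (cox_eq_cons2 _ y)) _; exact: cox_eq_consl.
  have /= := red _ e4; rewrite size_cat size_alt_seq => le.
  have /minp : `[< Q (size l3) >].
    by apply/asboolP; exists k.+1, a, b, l3; split => //; lia.
  by lia.
have ab_neq : a <> b by case: ab => -[-> ->] // E; apply: st.
(* A prefix longer than [m] could be shortened by a braid relation followed by a cancellation. *)
have km : le_order k (M a b).
  rewrite /le_order; case Mab: (M a b) => [m|] //; rewrite leqNgt; apply/negP => mk.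
  have m1 := cox_offdiag ab_neq Mab.
  pose l3 := (if odd m.+1 then alt_seq (k - m.+1) b a else alt_seq (k - m.+1) a b) ++ l2.
  have : cox_eq (t :: l1) (alt_seq m.-1 b a ++ l3).
    apply: cox_eq_trans e _; rewrite -(subnKC mk) alt_seqD -catA -/l3.
    apply: cox_eq_cat; last exact: cox_eq_refl.
    case: m m1 Mab {mk l3} => // m _ Mab.
    apply: (cox_eq_trans (cox_eq_consl a (cox_eq_sym (cox_eq_braid ab_neq Mab)))).
    exact: cox_eq_cons2.
  move/red; rewrite /l3 /= !size_cat size_alt_seq.
  by case: (~~ odd m); rewrite size_alt_seq; lia.
have neg_s (l3 : seq I) : (size l3 < (size l1).+1)%N -> cox_eq (t :: l1) (s :: l3) ->
    neg_root (t :: l1) s -> neg_root (t :: l1) s /\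
    exists2 l', cox_eq (s :: t :: l1) l' & (size l' < size (t :: l1))%N.
  move=> lt e3 neg; split=> //; exists l3 => //.
  by apply: cox_eq_trans (cox_eq_consl s e3) (cox_eq_cons2 _ _).
have neg_alt a' b' : (a' = s /\ b' = t) -> le_order k (M s t) ->
    pos_root l2 (if odd k then a' else b') -> pos_root l2 (if odd k then b' else a') ->
    cox_eq (t :: l1) (alt_seq k a' b' ++ l2) -> neg_root (t :: l1) s.
  case=> -> -> km' pX pY e' f f0; rewrite (cox_act_eq f e') cox_act_cat.
  have [_ ->] := cox_act_alt k s t (cox_act l2 f).
  rewrite oppr_le0 addr_ge0 // mulr_ge0 ?pX ?pY ?cheb_ge0 //.
  case: (k) k0 km' => // k' _ km'; rewrite chebSS opprB addrCA subrr addr0.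
  by apply: cheb_ge0 => //; rewrite /le_order; case: (M s t) km' => // m /ltnW.
have neg_braid : cox_eq (t :: l1) (alt_seq k s t ++ l2) ->
    neg_root (t :: l1) s -> neg_root (t :: l1) s /\
    exists2 l', cox_eq (s :: t :: l1) l' & (size l' < size (t :: l1))%N.
  case: (k) k0 sz => // k' _ sz'; apply: neg_s.
  by rewrite size_cat size_alt_seq; lia.
case: ab => -[Ea Eb]; subst a b.
  by right; exact: (neg_braid e (neg_alt s t (conj erefl erefl) km posx posy e)).
rewrite cox_sym in km.
(* If [k] is the label, the braid relation makes the prefix begin with [s], which is then a descent.
   Otherwise [k] is smaller, and both coefficients [U_(k+1)] and [U_k] are nonnegative. *)
have [Mk|Mk] := pselect (M s t = Some k).
  have e' : cox_eq (t :: l1) (alt_seq k s t ++ l2).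
    apply: cox_eq_trans e (cox_eq_cat _ (cox_eq_refl _)).
    by apply: cox_eq_braid => //; rewrite cox_sym.
  by right; apply: (neg_braid e' (neg_alt s t (conj erefl erefl) km posy posx e')).
left=> f f0; rewrite (cox_act_eq f e) cox_act_cat.
have [-> _] := cox_act_alt k t s (cox_act l2 f); rewrite cox_formC.
rewrite addr_ge0 // mulr_ge0 ?posx ?posy ?cheb_ge0 //.
rewrite /le_order; case: (M s t) km Mk => // m /= km Mk.
by rewrite ltn_neqAle km andbT; apply/eqP => E; apply: Mk; rewrite E.
Qed.

(** Invariance of the form: the adjoint of [l] is [rev l]. *)
Lemma cox_act_gram l t :
  (fun x => cox_act l (cox_form x) t) = cox_act (rev l) (cox_form t).
Proof.
elim: l t => [|i l IHl] t; first by apply/funext => x /=; exact: cox_formC.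
rewrite rev_cons -cats1 cox_act_cat /=.
have -> : reflect i (cox_form t) = fun j => 1 * cox_form t j + - cox_form i t * cox_form i j.
  by apply/funext => j; rewrite /reflect (cox_formC t i); ring.
by rewrite cox_actD -!IHl; apply/funext => x; rewrite /reflect; ring.
Qed.

(** Faithfulness of the representation: the first letter [s] of a nonempty reduced word is a
    descent, so the constant function 1 would be sent to a function with value at most 0 at [s]. *)
Lemma cox_act_pos_trivial l : (forall s, 0 < cox_act l (fun=> 1) s) -> cox_eq l [::].
Proof.
move=> posl; have [l' e red] := reduced_ex l.
case: l' e red => // s l' e red; exfalso.
have red' : reduced l'.
  by move=> l2 e2; have := red _ (cox_eq_consl s e2).
have := posl s; rewrite (cox_act_eq _ e) /= reflect_diag.
have [pos|[_ [l2 e2 lt]]] := tits_dichotomy s red'; last first.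
  by have := red _ e2; rewrite /=; lia.
have /(pos _) : nonneg (fun=> 1) by move=> ?; exact: ler01.
by lra.
Qed.

Lemma pos_or_neg_root l s : pos_root l s \/ neg_root l s.
Proof.
have [l' e red] := reduced_ex l.
have [pos|[neg _]] := tits_dichotomy s red; [left|right] => f f0;
  by rewrite (cox_act_eq _ e); auto.
Qed.

Definition coord i : I -> R := fun j => if pselect (i = j) then 1 else 0.

Lemma coord_diag i : coord i i = 1.
Proof. by rewrite /coord; case: pselect. Qed.

Lemma coord_neq i j : i <> j -> coord i j = 0.
Proof. by rewrite /coord; case: pselect. Qed.

Lemma coord_ge0 i : nonneg (coord i).
Proof. by move=> j; rewrite /coord; case: pselect. Qed.

(** Only a multiple of the simple root of [i] can change sign under the reflection in [i], and norm
    2 forces the factor 1. *)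
Lemma simple_root l y i : pos_root l y -> neg_root (rcons l i) y ->
  forall f, cox_act l f y = f i.
Proof.
move=> pos neg; pose a := cox_act l (coord i) y.
have scale_nonneg f : nonneg f -> cox_act l f y = a * f i.
  (* [f'] vanishes at [i], hence is fixed by the reflection, and the two sign hypotheses force its
     value to be 0. *)
  move=> f0; pose f' := fun j => 1 * f j + - f i * coord i j.
  have f'0 : nonneg f'.
    move=> j; rewrite /f'; have [<-|ij] := pselect (i = j); first by rewrite coord_diag; lra.
    by rewrite coord_neq // mulr0 addr0 mul1r.
  have E : cox_act l f' y = cox_act (rcons l i) f' y.
    rewrite -cats1 cox_act_cat /=; congr (cox_act l _ y); apply/funext => j.
    by rewrite /reflect /f' coord_diag; ring.
  have /eqP : cox_act l f' y = 0.
    by apply/eqP; rewrite eq_le [X in X <= _]E neg //= pos.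
  rewrite /f' cox_actD -/a => /eqP; lra.
have scale f : cox_act l f y = a * f i.
  pose f1 j := `|f j|; pose f2 j := 1 * f1 j + -1 * f j.
  have -> : f = fun j => 1 * f1 j + -1 * f2 j by apply/funext => j; rewrite /f2; ring.
  rewrite cox_actD !scale_nonneg; first by ring.
    by move=> j; rewrite /f2 /f1; have := ler_norm (f j); lra.
  by move=> j; exact: normr_ge0.
have a0 : 0 <= a by apply: pos; exact: coord_ge0.
have : cox_act l (fun x => cox_act l (cox_form x) y) y = 2.
  by rewrite cox_act_gram cox_actVK cox_form_diag.
rewrite scale scale cox_form_diag => aa2.
have a1 : a = 1 by nra.
by move=> f; rewrite scale a1 mul1r.
Qed.

(* [t] is a descent of [l], and the condition on the sum passes to the shorter word with the
   roles of [s] and [t] exchanged, so that one could descend forever. *)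
Lemma no_infinite_descent l s t : s <> t -> M s t = None ->
  cox_act l (fun=> 1) t < 0 -> 0 <= cox_act l (fun=> 1) s + cox_act l (fun=> 1) t.
Proof.
move=> st Mst; rewrite leNgt; set f := cox_act l _ => ft; apply/negP => fst.
have [l0 e0 red] := reduced_ex l; rewrite /f (cox_act_eq _ e0) in ft fst.
move: {l f e0} l0 s t st Mst red ft fst => l.
have [n le_n] := ubnP (size l); elim: n l le_n => // n IHn l le_n s t st Mst red ft fst.
have n1 : nonneg (fun=> 1) by move=> ?; exact: ler01.
have [pos|[_ [l1 e1 lt]]] := tits_dichotomy t red.
  by have := pos _ n1; rewrite leNgt ft.
have [l2 e2 red2] := reduced_ex l1.
have le2 := red2 _ (cox_eq_sym e2).
have E : cox_act l2 (fun=> 1) = reflect t (cox_act l (fun=> 1)).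
  by rewrite -(cox_act_eq _ e2) -(cox_act_eq _ e1).
apply: (IHn l2 _ t s) => //; first by lia.
- by move/esym.
- by rewrite cox_sym.
- by rewrite E /reflect cox_formC /cox_form Mst /=; lra.
- by rewrite E reflect_diag /reflect cox_formC /cox_form Mst /=; lra.
Qed.

End GeometricRepresentation.

(** * Actions of virtual Artin groups *)

Local Open Scope group_scope.
Local Open Scope quotient_scope.

Fixpoint alt_iter (Z : Type) (k : nat) (f g : Z -> Z) (z : Z) : Z :=
  if k is k'.+1 then f (alt_iter k' g f z) else z.

Definition word_act (X Z : Type) (A : X -> bool -> Z -> Z) (w : word X) (z : Z) : Z :=
  foldl (fun z l => A l.1 l.2 z) z w.

Section WordAction.
Variables (X Z : Type) (A : X -> bool -> Z -> Z).

Lemma word_act_cat u v z : word_act A (u ++ v) z = word_act A v (word_act A u z).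
Proof. exact: foldl_cat. Qed.

Lemma word_act_alternating k a b z :
  word_act A (alternating k a b) z = alt_iter k (A a false) (A b false) z.
Proof. by elim: k a b => //= k IHk a b; rewrite word_act_cat IHk. Qed.

End WordAction.

(** The universal property of a presentation, phrased with right actions so that no group of
    permutations has to be built. *)
Lemma pres_act (X : choiceType) (Z : Type) (R : word X -> word X -> Prop)
    (A : X -> bool -> Z -> Z) :
  (forall x b z, A x (~~ b) (A x b z) = z) ->
  (forall u v, R u v -> forall z, word_act A u z = word_act A v z) ->
  forall u v, pres_eq R u v -> forall z, word_act A u z = word_act A v z.
Proof.
move=> AK AR u v.
elim=> {u v} [u v uv z|x b z|//|u v _ IH z|u v w _ IH1 _ IH2 z|u u' v v' _ IH1 _ IH2 z].
- exact: AR.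
- exact: AK.
- by rewrite IH.
- by rewrite IH1.
- by rewrite !word_act_cat IH1 IH2.
Qed.

Definition letter_val (X : Type) (H : groupType) (f : X -> H) (l : X * bool) : H :=
  if l.2 then (f l.1)^-1 else f l.1.

Section PresentedGroup.
Variables (X : choiceType) (R : word X -> word X -> Prop).
Local Notation G := (presented_group R).

Definition cls (w : word X) : G := \pi_(G) w.

Lemma cls_eq u v : (cls u = cls v) <-> pres_eq R u v.
Proof. exact: presented_groupP. Qed.

Lemma cls_cat u v : cls (u ++ v) = cls u * cls v.
Proof.
by apply/cls_eq/pres_sym/pres_cat; exact: repr_presented.
Qed.

Lemma cls_nil : cls [::] = 1.
Proof. by []. Qed.

Lemma cls_surj (g : G) : exists w, g = cls w.
Proof. by exists (repr g); rewrite /cls reprK. Qed.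

Lemma cls_gen_inv x : cls [:: (x, true)] = (cls (gen x))^-1.
Proof.
apply: (mulgI (cls (gen x))); rewrite mulgV -cls_cat.
exact/cls_eq/(pres_cancel R x false).
Qed.

Lemma cls1 l : cls [:: l] = letter_val (fun x => cls (gen x)) l.
Proof. by case: l => x [] //; rewrite cls_gen_inv. Qed.

End PresentedGroup.

(** * Values of words and alternating products in a group *)

Definition word_val (X : Type) (H : groupType) (f : X -> H) (w : word X) : H :=
  foldr (fun l g => letter_val f l * g) 1 w.

Lemma word_val_cat (X : Type) (H : groupType) (f : X -> H) u v :
  word_val f (u ++ v) = word_val f u * word_val f v.
Proof. by elim: u => /= [|l u ->]; rewrite ?mul1g ?mulgA. Qed.

Lemma word_val1 (X : Type) (H : groupType) (f : X -> H) l : word_val f [:: l] = letter_val f l.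
Proof. exact: mulg1. Qed.

Lemma word_val_inv (X : Type) (H : groupType) (f : X -> H) w :
  word_val f (inv_word w) = (word_val f w)^-1.
Proof.
elim: w => [|[x b] w IHw] /=; first by rewrite invg1.
rewrite /inv_word /= rev_cons -cats1 word_val_cat IHw word_val1 invgM.
by case: b; rewrite /letter_val /= ?invgK.
Qed.

Definition alt_prod (H : groupType) (k : nat) (x y : H) : H :=
  alt_iter k ( *%g^~ x) ( *%g^~ y) 1.

Lemma alt_iter_mul (H : groupType) (k : nat) (x y z : H) :
  alt_iter k ( *%g^~ x) ( *%g^~ y) z = z * alt_prod k x y.
Proof.
rewrite /alt_prod; elim: k x y => /= [|k IHk] x y; first by rewrite mulg1.
by rewrite IHk mulgA.
Qed.

Lemma alt_prodS (H : groupType) (k : nat) (x y : H) : alt_prod k.+1 x y = alt_prod k y x * x.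
Proof. by []. Qed.

Lemma alt_prod_conj (H : groupType) k (x y g : H) :
  alt_prod k (g * x * g^-1) (g * y * g^-1) = g * alt_prod k x y * g^-1.
Proof.
elim: k x y => [|k IHk] x y; first by rewrite mulg1 mulgV.
by rewrite !alt_prodS IHk !mulgA mulgVK.
Qed.

Lemma alt_iter_fix (Z : Type) k (f g : Z -> Z) z :
  f z = z -> g z = z -> alt_iter k f g z = z.
Proof. by elim: k f g => //= k IHk f g fz gz; rewrite IHk. Qed.

Lemma alt_iter_morph (Z Z' : Type) (h : Z -> Z') k f g f' g' z :
  (forall z, h (f z) = f' (h z)) -> (forall z, h (g z) = g' (h z)) ->
  h (alt_iter k f g z) = alt_iter k f' g' (h z).
Proof. by elim: k f g f' g' => //= k IHk f g f' g' Ef Eg; rewrite Ef (IHk g f g' f'). Qed.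

(** * Projection and linear representation of the virtual Artin group *)

Section VA.
Variables (R : realType) (S : choiceType) (M : coxeter_matrix S).
Local Notation G := (virtual_artin M).
Implicit Types (s t : S) (g h : G) (u v w : word (S + S)).

Definition vsigma s : G := cls _ (gen (sigma s)).
Definition vtau s : G := cls _ (gen (tau s)).

(** The hypotheses are, in order, inverse letters, VA1, the two parts of VA2, and VA3, all read from
    left to right as right actions. *)
Lemma va_act (Z : Type) (A : S + S -> bool -> Z -> Z) :
  (forall x b z, A x (~~ b) (A x b z) = z) ->
  (forall s t m, s <> t -> M s t = Some m -> forall z,
     alt_iter m (A (inl s) false) (A (inl t) false) z =
     alt_iter m (A (inl t) false) (A (inl s) false) z) ->
  (forall s t m, s <> t -> M s t = Some m -> forall z,
     alt_iter m (A (inr s) false) (A (inr t) false) z =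
     alt_iter m (A (inr t) false) (A (inr s) false) z) ->
  (forall s z, A (inr s) false (A (inr s) false z) = z) ->
  (forall s t m, s <> t -> M s t = Some m -> forall z,
     A (inl t) false (alt_iter m.-1 (A (inr s) false) (A (inr t) false) z) =
     alt_iter m.-1 (A (inr s) false) (A (inr t) false)
       (A (inl (if odd m then s else t)) false z)) ->
  forall u v, cls (va_rel M) u = cls _ v -> forall z, word_act A u z = word_act A v z.
Proof.
move=> AK A1 A2 A2' A3 u v /cls_eq; apply: pres_act => // {}u {}v [].
- by move=> s t m st Mst z; rewrite !word_act_alternating A1.
- by move=> s t m st Mst z; rewrite !word_act_alternating A2.
- by move=> s z; exact: A2'.
- move=> s t m st Mst P r z; rewrite /P !word_act_cat !word_act_alternating.
  by rewrite /= A3.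
Qed.

Lemma cls_alternating k (a b : S + S) :
  cls (va_rel M) (alternating k a b) = alt_prod k (cls _ (gen a)) (cls _ (gen b)).
Proof. by elim: k a b => //= k IHk a b; rewrite cls_cat IHk. Qed.

Lemma vsigma_braid s t m : s <> t -> M s t = Some m ->
  alt_prod m (vsigma s) (vsigma t) = alt_prod m (vsigma t) (vsigma s).
Proof.
by move=> st Mst; rewrite -!cls_alternating; apply/cls_eq/pres_rel/(VA1 st Mst).
Qed.

Lemma vtau_braid s t m : s <> t -> M s t = Some m ->
  alt_prod m (vtau s) (vtau t) = alt_prod m (vtau t) (vtau s).
Proof.
by move=> st Mst; rewrite -!cls_alternating; apply/cls_eq/pres_rel/(VA2 st Mst).
Qed.

Lemma vtau2 s : vtau s * vtau s = 1.
Proof. by rewrite -cls_cat; apply/cls_eq/pres_rel/(VA2_inv M s). Qed.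

Lemma vtauV s : (vtau s)^-1 = vtau s.
Proof. by apply: mulg1_eq; exact: vtau2. Qed.

Lemma vtau_vsigma s t m : s <> t -> M s t = Some m ->
  alt_prod m.-1 (vtau s) (vtau t) * vsigma t =
  vsigma (if odd m then s else t) * alt_prod m.-1 (vtau s) (vtau t).
Proof.
move=> st Mst; rewrite -!cls_alternating -!cls_cat; apply/cls_eq/pres_rel.
exact: (VA3 st Mst).
Qed.

Lemma va_ind (P : G -> Prop) : P 1 ->
  (forall g s b, P g -> P (g * letter_val vsigma (s, b))) ->
  (forall g s, P g -> P (g * vtau s)) -> forall g, P g.
Proof.
move=> P1 Ps Pt g; have [w ->] := cls_surj g.
elim/last_ind: w => [|w [[s|s] b] IHw]; first exact: P1.
  by rewrite -cats1 cls_cat cls1; exact: (Ps _ s b).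
rewrite -cats1 cls_cat cls1.
have -> : letter_val (fun x => cls (va_rel M) (gen x)) (inr s, b) = vtau s.
  by case: b; rewrite /letter_val //=; exact: vtauV.
exact: Pt.
Qed.

(** W is realised inside G as the subgroup generated by the [tau_s]. Killing the [sigma_s] then
    becomes an idempotent endomorphism of G, obtained from an action of words on G by right
    multiplication. *)
Definition proj_letter (x : S + S) (b : bool) (g : G) : G :=
  if x is inr s then g * vtau s else g.

Lemma proj_letter_act u v : cls (va_rel M) u = cls _ v ->
  forall g, word_act proj_letter u g = word_act proj_letter v g.
Proof.
apply: va_act.
- by case=> s b g //=; rewrite -mulgA vtau2 mulg1.
- by move=> s t m _ _ g; rewrite !alt_iter_fix.
- by move=> s t m st Mst g; rewrite /= !alt_iter_mul (vtau_braid st Mst).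
- by move=> s g /=; rewrite -mulgA vtau2 mulg1.
- by [].
Qed.

Definition va_proj g : G := word_act proj_letter (repr g) 1.

Lemma va_proj_cls w : va_proj (cls _ w) = word_act proj_letter w 1.
Proof. by apply: proj_letter_act; rewrite /cls reprK. Qed.

Lemma word_act_proj_letter w g :
  word_act proj_letter w g = g * word_act proj_letter w 1.
Proof.
elim/last_ind: w => [|w [[s|s] b] IHw]; first by rewrite mulg1.
  by rewrite -cats1 !word_act_cat /= IHw.
by rewrite -cats1 !word_act_cat /= IHw mulgA.
Qed.

Lemma va_projM : {morph va_proj : g h / g * h}.
Proof.
move=> g h; have [u ->] := cls_surj g; have [v ->] := cls_surj h.
by rewrite -cls_cat !va_proj_cls word_act_cat word_act_proj_letter.
Qed.

Lemma va_proj1 : va_proj 1 = 1.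
Proof. by rewrite -(cls_nil (va_rel M)) va_proj_cls. Qed.

Lemma va_projV g : va_proj g^-1 = (va_proj g)^-1.
Proof. by apply: (mulIg (va_proj g)); rewrite mulVg -va_projM mulVg va_proj1. Qed.

Lemma va_proj_vsigma s : va_proj (vsigma s) = 1.
Proof. by rewrite va_proj_cls. Qed.

Lemma va_proj_vtau s : va_proj (vtau s) = vtau s.
Proof. by rewrite va_proj_cls /= mul1g. Qed.

Lemma va_proj_letter s b : va_proj (letter_val vsigma (s, b)) = 1.
Proof. by case: b; rewrite /letter_val /= ?va_projV va_proj_vsigma ?invg1. Qed.

Lemma va_projK g : va_proj (va_proj g) = va_proj g.
Proof.
elim/va_ind: g => [|g s b IHg|g s IHg]; first by rewrite !va_proj1.
  by rewrite va_projM va_proj_letter mulg1.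
by rewrite !va_projM IHg !va_proj_vtau.
Qed.

Definition lin_letter (x : S + S) (b : bool) (f : S -> R) : S -> R :=
  if x is inr s then reflect M s f else f.

Lemma alt_iter_reflect k s t (f : S -> R) :
  alt_iter k (reflect M s) (reflect M t) f = cox_act M (alt_seq k s t) f.
Proof. by elim: k s t => //= k IHk s t; rewrite IHk. Qed.

Lemma lin_letter_act u v : cls (va_rel M) u = cls _ v ->
  forall f, word_act lin_letter u f = word_act lin_letter v f.
Proof.
apply: va_act.
- by case=> s b f //=; rewrite reflectK.
- by move=> s t m _ _ f; rewrite !alt_iter_fix.
- by move=> s t m st Mst f; rewrite /= !alt_iter_reflect (cox_act_braid f st Mst).
- by move=> s f /=; rewrite reflectK.
- by [].
Qed.

Definition va_lin g (f : S -> R) : S -> R := word_act lin_letter (repr g) f.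

Lemma va_lin_cls w f : va_lin (cls _ w) f = word_act lin_letter w f.
Proof. by apply: lin_letter_act; rewrite /cls reprK. Qed.

Lemma va_linM g h f : va_lin (g * h) f = va_lin h (va_lin g f).
Proof.
have [u ->] := cls_surj g; have [v ->] := cls_surj h.
by rewrite -cls_cat !va_lin_cls word_act_cat.
Qed.

Lemma va_lin1 f : va_lin 1 f = f.
Proof. by rewrite -(cls_nil (va_rel M)) va_lin_cls. Qed.

Lemma va_lin_vtau s f : va_lin (vtau s) f = reflect M s f.
Proof. by rewrite va_lin_cls. Qed.

Lemma va_lin_letter s b f : va_lin (letter_val vsigma (s, b)) f = f.
Proof.
have -> : letter_val vsigma (s, b) = cls _ [:: (inl s, b)] by rewrite cls1.
by rewrite va_lin_cls.
Qed.

Lemma va_lin_proj g f : va_lin (va_proj g) f = va_lin g f.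
Proof.
elim/va_ind: g f => [|g s b IHg|g s IHg] f; first by rewrite va_proj1.
  by rewrite va_projM va_proj_letter mulg1 IHg va_linM va_lin_letter.
by rewrite va_projM !va_linM va_proj_vtau IHg.
Qed.

(** One list computes both maps. It is reversed in the second because [va_lin] is a right action,
    while [cox_act] applies its last letter first. *)
Lemma va_proj_seq g : exists l : seq S,
  va_proj g = foldl (fun h s => h * vtau s) 1 l /\
  forall f, va_lin g f = cox_act M (rev l) f.
Proof.
elim/va_ind: g => [|g s b [l [Ep El]]|g s [l [Ep El]]].
- by exists [::]; split=> [|f]; rewrite ?va_proj1 ?va_lin1.
- exists l; split=> [|f]; first by rewrite va_projM va_proj_letter mulg1.
  by rewrite va_linM va_lin_letter.
- exists (rcons l s); split=> [|f].
    by rewrite va_projM va_proj_vtau Ep -cats1 foldl_cat.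
  by rewrite va_linM va_lin_vtau El rev_rcons.
Qed.

End VA.

(** * The roots and the Artin presentation of the kernel *)

Section VAIndex.
Variables (R : realType) (S : choiceType) (M : coxeter_matrix S).
Local Notation G := (virtual_artin M).
Local Notation vsigma := (vsigma M).
Local Notation vtau := (vtau M).
Local Notation va_proj := (@va_proj S M).
Local Notation va_lin := (@va_lin R S M).
Implicit Types (s t : S) (g h u v w : G).

(* A root of the Coxeter group is recorded together with the conjugate of a [sigma] attached to
   it, so that it need not be shown that the root determines this conjugate. *)
Definition idx_pair u s : G * ((S -> R) -> R) :=
  (va_proj u * vsigma s * (va_proj u)^-1, fun f => va_lin u f s).

Definition Idx : Type := {x | exists u s, x = idx_pair u s}.

Definition idx u s : Idx := exist _ (idx_pair u s) (ex_intro _ u (ex_intro _ s erefl)).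

Implicit Types (i j : Idx).

Definition ival i : G := (sval i).1.
Definition iroot i : (S -> R) -> R := (sval i).2.

Lemma idx_inj i j : ival i = ival j -> iroot i = iroot j -> i = j.
Proof.
case: i j => [[g r] p] [[h q] p']; rewrite /ival /iroot /= => E1 E2.
by apply: eq_exist; rewrite E1 E2.
Qed.

Lemma idxP i : exists u s, i = idx u s.
Proof. by case: i => x [u [s E]]; exists u, s; apply: eq_exist. Qed.

Lemma ishift_subproof w i : exists u s,
  (va_proj w * ival i * (va_proj w)^-1, fun f => iroot i (va_lin w f)) = idx_pair u s.
Proof.
have [u [s ->]] := idxP i; exists (w * u), s.
rewrite /idx_pair /ival /iroot /= va_projM invgM !mulgA; congr pair.
by apply/funext => f; rewrite va_linM.
Qed.

Definition ishift w i : Idx := exist _ _ (ishift_subproof w i).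

Lemma ishift_idx w u s : ishift w (idx u s) = idx (w * u) s.
Proof.
apply: idx_inj; rewrite /ival /iroot /=; first by rewrite va_projM invgM !mulgA.
by apply/funext => f; rewrite va_linM.
Qed.

Lemma ishiftM w w' i : ishift (w * w') i = ishift w (ishift w' i).
Proof. by have [u [s ->]] := idxP i; rewrite !ishift_idx mulgA. Qed.

Lemma ishift1 i : ishift 1 i = i.
Proof. by have [u [s ->]] := idxP i; rewrite !ishift_idx mul1g. Qed.

Lemma ishiftVK w : cancel (ishift w^-1) (ishift w).
Proof. by move=> i; rewrite -ishiftM mulgV ishift1. Qed.

Lemma ival_ishift w i : ival (ishift w i) = va_proj w * ival i * (va_proj w)^-1.
Proof. by []. Qed.

Lemma idx_proj u s : idx (va_proj u) s = idx u s.
Proof.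
apply: idx_inj; rewrite /ival /iroot /=; first by rewrite va_projK.
by apply/funext => f; rewrite va_lin_proj.
Qed.

(** The form on roots, which are functionals: the inner one turns root [j] into the function pairing
    it with the simple roots, and root [i] is applied to that function. *)
Definition gram i j : R := iroot i (fun x => iroot j (cox_form R M x)).

Lemma gram_idx u s t : gram (idx u s) (idx u t) = cox_form R M s t.
Proof.
rewrite /gram /iroot /=; have [l [_ El]] := va_proj_seq R u.
have -> : (fun x => va_lin u (cox_form R M x) t) = cox_act M l (cox_form R M t).
  rewrite -[l in RHS]revK -cox_act_gram.
  by apply/funext => x; rewrite El.
by rewrite El cox_actK cox_formC.
Qed.

Lemma iroot_vtau u s f : iroot (idx (u * vtau s) s) f = (- iroot (idx u s) f)%R.
Proof. by rewrite /iroot /= va_linM va_lin_vtau reflect_diag. Qed.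

Lemma gram_vtau u s t :
  gram (idx (u * vtau s) s) (idx u t) = (- cox_form R M s t)%R.
Proof. by rewrite -(gram_idx u) /gram iroot_vtau. Qed.

Definition fin_pair i j m := exists u s t,
  [/\ i = idx u s, j = idx u t, s <> t & M s t = Some m].

Lemma fin_pair_gram i j m : fin_pair i j m ->
  gram i j = (- coxcos R m)%R /\ (1 < m)%N.
Proof.
move=> [u [s [t [-> -> st Mst]]]]; rewrite gram_idx /cox_form Mst; split=> //.
exact: cox_offdiag st Mst.
Qed.

Lemma gram_diag i : gram i i = 2%R.
Proof. by have [u [s ->]] := idxP i; rewrite gram_idx cox_form_diag. Qed.

Lemma fin_pair_neq i j m : fin_pair i j m -> i <> j.
Proof.
move=> /fin_pair_gram[+ m1] E; rewrite E gram_diag.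
by have /andP[c0 _] := coxcos_bounds R m1; lra.
Qed.

(** The Gram entry determines the label, whatever translate of a simple pair is used. *)
Lemma fin_pair_uniq i j m n : fin_pair i j m -> fin_pair i j n -> m = n.
Proof.
move=> /fin_pair_gram[E1 m1] /fin_pair_gram[E2 n1].
by apply: (@coxcos_inj R); [lia|lia|apply: oppr_inj; rewrite -E1 -E2].
Qed.

Lemma fin_pair_sym i j m : fin_pair i j m -> fin_pair j i m.
Proof.
move=> [u [s [t [-> -> st Mst]]]]; exists u, t, s; split=> //; last by rewrite cox_sym.
by move=> /esym.
Qed.

Definition ind_m i j : option nat :=
  if pselect (i = j) then Some 1%N
  else if pselect (exists m, fin_pair i j m) is left H then Some (projT1 (cid H)) else None.

Lemma ind_mP i j m : i <> j -> ind_m i j = Some m <-> fin_pair i j m.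
Proof.
rewrite /ind_m => ij; case: (pselect (i = j)) => [ij'|ij']; first by [].
case: (pselect (exists m, fin_pair i j m)) => [H|H]; split=> //.
- by case=> <-; exact: projT2 (cid H).
- by move=> fp; rewrite (fin_pair_uniq (projT2 (cid H)) fp).
- by move=> fp; case: H; exists m.
Qed.

Lemma ind_m_sym i j : ind_m i j = ind_m j i.
Proof.
have [->|ij] := pselect (i = j); first by [].
have ji : j <> i by move/esym.
case E: (ind_m j i) => [m|].
  by apply/(ind_mP _ ij)/fin_pair_sym/(ind_mP _ ji).
case E': (ind_m i j) => [m|] //.
by move/(ind_mP _ ij)/fin_pair_sym/(ind_mP _ ji) : E'; rewrite E.
Qed.

Lemma ind_m_diag i : ind_m i i = Some 1%N.
Proof. by rewrite /ind_m; case: pselect. Qed.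

Lemma ind_m_offdiag i j k : i <> j -> ind_m i j = Some k -> (2 <= k)%N.
Proof. by move=> ij /(ind_mP _ ij) /fin_pair_gram[]. Qed.

Definition ind_matrix : coxeter_matrix Idx :=
  CoxeterMatrix ind_m_sym ind_m_diag ind_m_offdiag.

(** At the translate of the constant function 1 the two roots take the values -1 and 1. *)
Lemma idx_neg_neq u s t : idx (u * vtau s) s <> idx u t.
Proof.
move=> E; have := congr1 (fun i => iroot i (va_lin u^-1 (fun=> 1%R))) E.
rewrite iroot_vtau /iroot /= -!va_linM mulVg va_lin1; lra.
Qed.

(** The Gram entry is -2, whereas a finite label gives more than -2. *)
Lemma ind_m_opp u s : ind_matrix (idx u s) (idx (u * vtau s) s) = None.
Proof.
rewrite cox_sym; case E: (ind_matrix _ _) => [m|] //; exfalso.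
have /(ind_mP _ (@idx_neg_neq u s s)) /fin_pair_gram[] := E; clear E.
by rewrite gram_vtau cox_form_diag => + /(coxcos_bounds R)/andP[]; lra.
Qed.

(** Passing to the opposite of [alpha_s] makes the Gram entry positive, whereas a finite label gives
    at most 0. *)
Lemma ind_m_edge u s t : coxeter_edge M s t ->
  ind_matrix (idx (u * vtau s) s) (idx u t) = None.
Proof.
move=> /andP[_ edge]; case E: (ind_matrix _ _) => [m|] //; exfalso.
have /(ind_mP _ (@idx_neg_neq u s t)) /fin_pair_gram[] := E; clear E.
rewrite gram_vtau /cox_form => + /(coxcos_bounds R)/andP[c0 c2].
case: (M s t) edge => [k|_] /=; last by lra.
by move=> /(coxcos_gt0 R); lra.
Qed.

Lemma ival_braid i j m : i <> j -> ind_matrix i j = Some m ->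
  alt_prod m (ival i) (ival j) = alt_prod m (ival j) (ival i).
Proof.
move=> ij /(ind_mP _ ij)[u [s [t [-> -> st Mst]]]].
by rewrite /ival /= !alt_prod_conj (vsigma_braid st Mst).
Qed.

Lemma va_proj_alt k s t :
  va_proj (alt_prod k (vtau s) (vtau t)) = alt_prod k (vtau s) (vtau t).
Proof.
elim: k s t => [|k IHk] s t; first exact: va_proj1.
by rewrite !alt_prodS va_projM IHk va_proj_vtau.
Qed.

Lemma va_lin_alt k s t f :
  va_lin (alt_prod k (vtau s) (vtau t)) f = cox_act M (alt_seq k s t) f.
Proof.
elim: k s t f => [|k IHk] s t f; first exact: va_lin1.
by rewrite alt_prodS va_linM IHk va_lin_vtau.
Qed.

(** VA3 settles the conjugates of the sigmas. For the roots, [U_m = 0] and [U_(m-1) = 1] show that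
    the dihedral element carries the root of [t] to a simple root. *)
Lemma idx_alt u s t m : s <> t -> M s t = Some m ->
  idx (u * alt_prod m.-1 (vtau s) (vtau t)) t = idx u (if odd m then s else t).
Proof.
move=> st Mst; apply: idx_inj; rewrite /ival /iroot /=.
  rewrite va_projM va_proj_alt invgM !mulgA -(mulgA _ _ (vsigma t)).
  by rewrite vtau_vsigma // !mulgA mulgK.
apply/funext => f; rewrite va_linM va_lin_alt; move: (va_lin u f) => {}f.
have m1 := cox_offdiag st Mst; have [U0 _] := cheb_order R m1.
have [-> _] := cox_act_alt M m.-1 s t f.
have U1 : cheb (coxcos R m) m.-1 = 1%R.
  by rewrite -subn1 cheb_sym // 1?ltnW // cheb1.
rewrite (cox_formK R Mst) prednK ?U0 ?U1; last by lia.
by rewrite mul0r add0r mul1r; case: (m) m1 => // k _ /=; case: (odd k).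
Qed.

Lemma letter_val_ival u s b :
  letter_val ival (idx u s, b) = va_proj u * letter_val vsigma (s, b) * (va_proj u)^-1.
Proof. by case: b; rewrite /letter_val /ival /= ?invgM ?invgK ?mulgA. Qed.

Local Notation wval := (word_val ival).

Lemma va_proj_wval (x : word Idx) : va_proj (wval x) = 1.
Proof.
elim: x => [|[i b] x IHx] /=; first exact: va_proj1.
have [u [s ->]] := idxP i; rewrite va_projM IHx mulg1 letter_val_ival !va_projM.
by rewrite va_proj_letter mulg1 va_projV mulgV.
Qed.

(** G is the product of N and W: appending [sigma_s] to [g] appends the generator [idx g s] to the
    kernel part. *)
Lemma va_decomp g : exists x : word Idx, g = wval x * va_proj g.
Proof.
elim/va_ind: g => [|g s b [x Ex]|g s [x Ex]].
- by exists [::]; rewrite va_proj1 mulg1.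
- exists (x ++ [:: (idx g s, b)]).
  rewrite word_val_cat word_val1 letter_val_ival va_projM va_proj_letter mulg1.
  by rewrite !mulgA mulgVK -Ex.
- by exists x; rewrite va_projM mulgA -Ex va_proj_vtau.
Qed.

Lemma ker_va_proj g : va_proj g = 1 -> exists x : word Idx, g = wval x.
Proof. by move=> E; have [x ->] := va_decomp g; exists x; rewrite E mulg1. Qed.

Definition shift_word w (x : word Idx) : word Idx := [seq (ishift w l.1, l.2) | l <- x].

Lemma wval_shift w x : wval (shift_word w x) = va_proj w * wval x * (va_proj w)^-1.
Proof.
elim: x => [|[i b] x IHx] /=; first by rewrite mulg1 mulgV.
rewrite IHx; have -> : letter_val ival (ishift w i, b) =
    va_proj w * letter_val ival (i, b) * (va_proj w)^-1.
  by case: b; rewrite /letter_val /= ival_ishift ?invgM ?invgK ?mulgA.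
by rewrite !mulgA mulgVK.
Qed.

(** * Extending an action of the generators of the kernel to the whole group *)

Section LiftedAction.
Variables (Z : Type) (A : Idx -> bool -> Z -> Z).
Hypothesis AK : forall i b z, A i (~~ b) (A i b z) = z.
Hypothesis A_braid : forall i j m, i <> j -> ind_matrix i j = Some m ->
  forall z, alt_iter m (A i false) (A j false) z = alt_iter m (A j false) (A i false) z.

(* [G] acts on [Z * G] by letting [sigma_s] act on [Z], at the state [u], as the generator with
   index [idx u s], while [tau_s] moves the state. *)
Definition lift_letter (x : S + S) (b : bool) (zu : Z * G) : Z * G :=
  match x with
  | inl s => (A (idx zu.2 s) b zu.1, zu.2)
  | inr s => (zu.1, zu.2 * vtau s)
  end.

Lemma alt_lift_vtau k s t zu :
  alt_iter k (lift_letter (inr s) false) (lift_letter (inr t) false) zu =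
  (zu.1, zu.2 * alt_prod k (vtau s) (vtau t)).
Proof.
rewrite -alt_iter_mul; case: zu => z u /=.
by rewrite (@alt_iter_morph _ _ (fun u => (z, u)) k _ _
  (lift_letter (inr s) false) (lift_letter (inr t) false)).
Qed.

Lemma alt_lift_vsigma k s t zu :
  alt_iter k (lift_letter (inl s) false) (lift_letter (inl t) false) zu =
  (alt_iter k (A (idx zu.2 s) false) (A (idx zu.2 t) false) zu.1, zu.2).
Proof.
case: zu => z u /=.
by rewrite (@alt_iter_morph _ _ (fun z => (z, u)) k _ _
  (lift_letter (inl s) false) (lift_letter (inl t) false)).
Qed.

Lemma lift_letter_act (w1 w2 : word (S + S)) : cls (va_rel M) w1 = cls _ w2 ->
  forall zu, word_act lift_letter w1 zu = word_act lift_letter w2 zu.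
Proof.
apply: va_act.
- by case=> s b [z g] /=; rewrite ?AK // -mulgA vtau2 mulg1.
- move=> s t m st Mst [z g]; rewrite !alt_lift_vsigma /=.
  have fp : fin_pair (idx g s) (idx g t) m by exists g, s, t.
  have ij := fin_pair_neq fp.
  by rewrite (A_braid ij) //; apply/ind_mP.
- by move=> s t m st Mst [z g]; rewrite !alt_lift_vtau (vtau_braid st Mst).
- by move=> s [z g] /=; rewrite -mulgA vtau2 mulg1.
- by move=> s t m st Mst [z g]; rewrite !alt_lift_vtau /= idx_alt.
Qed.

Definition lift_act g (zu : Z * G) : Z * G := word_act lift_letter (repr g) zu.

Lemma lift_act_cls (w : word (S + S)) zu : lift_act (cls _ w) zu = word_act lift_letter w zu.
Proof. by apply: lift_letter_act; rewrite /cls reprK. Qed.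

Lemma lift_actM g h zu : lift_act (g * h) zu = lift_act h (lift_act g zu).
Proof.
have [u ->] := cls_surj g; have [v ->] := cls_surj h.
by rewrite -cls_cat !lift_act_cls word_act_cat.
Qed.

Lemma lift_act1 zu : lift_act 1 zu = zu.
Proof. by rewrite -(cls_nil (va_rel M)) lift_act_cls. Qed.

Lemma lift_act_letter s b zu :
  lift_act (letter_val vsigma (s, b)) zu = (A (idx zu.2 s) b zu.1, zu.2).
Proof.
have -> : letter_val vsigma (s, b) = cls _ [:: (inl s, b)] by rewrite cls1.
by rewrite lift_act_cls.
Qed.

Lemma lift_act_proj g zu : lift_act (va_proj g) zu = (zu.1, zu.2 * va_proj g).
Proof.
elim/va_ind: g zu => [|g s b IHg|g s IHg] zu.
- by rewrite va_proj1 lift_act1 mulg1; case: zu.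
- by rewrite va_projM va_proj_letter mulg1 IHg.
- by rewrite va_projM va_proj_vtau lift_actM IHg lift_act_cls /= mulgA.
Qed.

Lemma lift_act_wval (x : word Idx) z : lift_act (wval x) (z, 1) = (word_act A x z, 1).
Proof.
elim: x z => [|[i b] x IHx] z; first by rewrite lift_act1.
rewrite /= lift_actM -IHx; congr lift_act.
have [u [s ->]] := idxP i.
rewrite letter_val_ival -va_projV !lift_actM lift_act_proj lift_act_letter.
by rewrite lift_act_proj /= mul1g idx_proj va_projV mulgV.
Qed.

(** The Artin presentation of the kernel. A generator [w sigma_s w^-1] moves the state to [w], lets
    the index [idx w s] act and moves back, so at the state 1 the lifted action, which depends only
    on the group element, returns the given one. *)
Theorem wval_act (x y : word Idx) : wval x = wval y ->
  forall z, word_act A x z = word_act A y z.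
Proof.
move=> E z; have := lift_act_wval x z; rewrite E lift_act_wval.
by case.
Qed.

End LiftedAction.

End VAIndex.

(** * Retraction onto a parabolic subgroup *)

(** Here [f] is applied first, the order in which a walk is read; [alt_iter] applies [f] last. *)
Fixpoint run (Z : Type) (n : nat) (f g : Z -> Z) (z : Z) : Z :=
  if n is n'.+1 then run n' g f (f z) else z.

Lemma alt_iterSr (Z : Type) k (f g : Z -> Z) z :
  alt_iter k.+1 f g z = alt_iter k f g ((if odd k then g else f) z).
Proof. by elim: k f g => //= k IHk f g; rewrite [in LHS]IHk /=; case: (odd k). Qed.

Lemma alt_iter_run (Z : Type) k (f g : Z -> Z) z :
  alt_iter k f g z = if odd k then run k f g z else run k g f z.
Proof.
elim: k f g z => // k IHk f g z; rewrite alt_iterSr IHk /=.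
by case: (odd k).
Qed.

Lemma sval_inj (T : Type) (P : T -> Prop) (z z' : {x | P x}) : sval z = sval z' -> z = z'.
Proof. by case: z z' => [x p] [x' p'] /= E; exact: eq_exist. Qed.

Lemma run_periodic (Z : Type) (r : nat -> Z -> Z) k0 k1 k2 z :
  (forall k, r k.+2 = r k) ->
  run (k1 + k2) (r k0) (r k0.+1) z =
  run k2 (r (k0 + k1)%N) (r (k0 + k1).+1) (run k1 (r k0) (r k0.+1) z).
Proof.
move=> per; elim: k1 k0 z => [|k1 IHk] k0 z; first by rewrite addn0.
by rewrite /= -(per k0) IHk addSnnS.
Qed.

Fixpoint word_in (X : Type) (Y : X -> Prop) (w : word X) : Prop :=
  if w is l :: w' then Y l.1 /\ word_in Y w' else True.

Section ArtinSystem.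
Variables (R : realType) (I : Type) (M : coxeter_matrix I) (H : groupType) (val : I -> H).

(* [artin_act] is the universal property of the Artin presentation, in terms of right actions. *)
Record artin_system : Prop := ArtinSystem {
  artin_braid : forall i j m, i <> j -> M i j = Some m ->
    alt_prod m (val i) (val j) = alt_prod m (val j) (val i);
  artin_act : forall (Z : Type) (A : I -> bool -> Z -> Z),
    (forall i b z, A i (~~ b) (A i b z) = z) ->
    (forall i j m, i <> j -> M i j = Some m ->
      forall z, alt_iter m (A i false) (A j false) z = alt_iter m (A j false) (A i false) z) ->
    forall x y : word I, word_val val x = word_val val y ->
    forall z, word_act A x z = word_act A y z
}.

Section Retraction.
Hypothesis artin : artin_system.
Variable Y : I -> Prop.
Local Notation F := (I -> R).
Local Notation cox_act := (@cox_act R I M).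
Local Notation reflect := (@reflect R I M).
Implicit Types (x : F -> F) (h : H) (i j : I).

Definition emits_at (phi : F -> R) y := Y y /\ forall f, phi f = f y.
Definition emits (phi : F -> R) := exists y, emits_at phi y.

Lemma emits_at_inj phi y y' : emits_at phi y -> emits_at phi y' -> y = y'.
Proof.
move=> [_ E] [_ E']; have [//|ne] := pselect (y = y').
have := E (coord R y); rewrite E' coord_diag coord_neq // => /eqP.
by rewrite eq_sym oner_eq0.
Qed.

(* If the coset of [x] is fixed by [i], the conjugate of [i] by the minimal representative is
   a generator in [Y], which is emitted; otherwise [i] moves to another coset. *)
Definition retract_step i b (xh : (F -> F) * H) : (F -> F) * H :=
  if pselect (emits (fun f => xh.1 f i)) is left E
  then (xh.1, xh.2 * letter_val val (projT1 (cid E), b))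
  else (fun f => reflect i (xh.1 f), xh.2).

Lemma retract_emit x h i b y : emits_at (fun f => x f i) y ->
  retract_step i b (x, h) = (x, h * letter_val val (y, b)).
Proof.
rewrite /retract_step => E; case: pselect => /= [E'|[]]; last by exists y.
by congr (_, _ * letter_val val (_, b)); exact: emits_at_inj (projT2 (cid E')) E.
Qed.

Lemma retract_move x h i b : ~ emits (fun f => x f i) ->
  retract_step i b (x, h) = (fun f => reflect i (x f), h).
Proof. by rewrite /retract_step; case: pselect. Qed.

(* The states are the inverses of the minimal representatives of the cosets of the parabolic
   subgroup generated by [Y]. *)
Definition min_rep x := exists2 l, x = cox_act l & forall y, Y y -> pos_root R M (rev l) y.

(** If minimality failed at [y], the reflection in [i] would turn a positive root negative. That
    root would be the simple root of [i], and [i] would emit [y]. *)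
Lemma min_rep_move x i : min_rep x -> ~ emits (fun f => x f i) ->
  min_rep (fun f => reflect i (x f)).
Proof.
move=> [l -> pos] ne; exists (i :: l) => // y Yy; rewrite rev_cons.
have [//|neg] := pos_or_neg_root R M (rcons (rev l) i) y.
case: ne; exists y; split=> // f.
by rewrite -(simple_root (pos y Yy) neg) cox_actK.
Qed.

Lemma min_rep_step i b x h : min_rep x -> min_rep (retract_step i b (x, h)).1.
Proof.
move=> mx; have [[y E]|ne] := pselect (emits (fun f => x f i)).
  by rewrite (retract_emit _ _ E).
by rewrite retract_move //; exact: min_rep_move.
Qed.

(** If the moved state emitted [y], the preimage of the constant function 1 would have value -1 at
    [y], against minimality. *)
Lemma retract_move_back x h i b : min_rep x -> ~ emits (fun f => x f i) ->
  retract_step i b (fun f => reflect i (x f), h) = (x, h).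
Proof.
move=> [l -> pos] ne; rewrite retract_move.
  by congr pair; apply/funext => f; rewrite reflectK.
move=> [y [Yy E]]; have := pos y Yy (fun=> 1%R) (fun=> ler01).
have := E (cox_act (rev l) (fun=> 1%R)).
by rewrite reflect_diag cox_actVK => <-; lra.
Qed.

Lemma retract_stepK i b x h : min_rep x ->
  retract_step i (~~ b) (retract_step i b (x, h)) = (x, h).
Proof.
move=> mx; have [[y E]|ne] := pselect (emits (fun f => x f i)).
  rewrite (retract_emit _ _ E) (retract_emit _ _ E); congr pair.
  by case: b; rewrite /letter_val /= ?mulgK ?mulgVK.
by rewrite retract_move // retract_move_back.
Qed.

(** * Walks in a rank-two subsystem *)

Section Dihedral.
Variables (i j : I) (m : nat) (x : F -> F).
Hypotheses (ij : i <> j) (Mij : M i j = Some m) (mx : min_rep x).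
Local Notation U := (cheb (coxcos R m)).

Definition dih_letter k := if odd k then j else i.

(** The state after [k] moves of the walk [i, j, i, ...] from [x], provided that none of them emits;
    [dih_root k] is the root that the next move tests. *)
Definition dih_state k : F -> F := fun f => cox_act (rev (alt_seq k i j)) (x f).

Definition dih_root k (f : F) : R := (U k.+1 * x f i + U k * x f j)%R.

Lemma dih_stateS k : dih_state k.+1 = fun f => reflect (dih_letter k) (dih_state k f).
Proof.
by apply/funext => f; rewrite /dih_state alt_seqSr rev_rcons.
Qed.

Lemma dih_state_root k : (fun f => dih_state k f (dih_letter k)) = dih_root k.
Proof.
apply/funext => f; rewrite /dih_state /dih_letter /dih_root rev_alt_seq.
rewrite -(cox_formK R Mij).
case: ifP => ok.
  by have [-> _] := cox_act_alt M k i j (x f); rewrite ok.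
by have [-> _] := cox_act_alt M k j i (x f); rewrite ok cox_formC.
Qed.

Section Free.
Variable n : nat.
Hypothesis free : forall k, (k < n)%N -> ~ emits (dih_root k).

Lemma dih_min_rep k : (k <= n)%N -> min_rep (dih_state k).
Proof.
elim: k => [|k IHk] kn; first exact: mx.
rewrite dih_stateS; apply: min_rep_move; first by apply: IHk; exact: ltnW.
by rewrite dih_state_root; exact: free.
Qed.

Lemma dih_up k h : (k < n)%N ->
  retract_step (dih_letter k) false (dih_state k, h) = (dih_state k.+1, h).
Proof.
move=> kn; rewrite retract_move ?dih_stateS //.
by rewrite dih_state_root; exact: free.
Qed.

Lemma dih_down k h : (k < n)%N ->
  retract_step (dih_letter k) false (dih_state k.+1, h) = (dih_state k, h).
Proof.
move=> kn; rewrite dih_stateS retract_move_back //.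
  by apply: dih_min_rep; exact: ltnW.
by rewrite dih_state_root; exact: free.
Qed.

Lemma dih_run_up c k h : (k + c <= n)%N ->
  run c (retract_step (dih_letter k) false) (retract_step (dih_letter k.+1) false)
    (dih_state k, h) = (dih_state (k + c), h).
Proof.
elim: c k => [|c IHc] k kc /=; first by rewrite addn0.
rewrite dih_up; last by lia.
have -> : dih_letter k = dih_letter k.+2 by rewrite /dih_letter /= negbK.
by rewrite IHc ?addnS //; lia.
Qed.

Lemma dih_run_down c k h : (c <= k.+1)%N -> (k < n)%N ->
  run c (retract_step (dih_letter k) false) (retract_step (dih_letter k.+1) false)
    (dih_state k.+1, h) = (dih_state (k.+1 - c), h).
Proof.
elim: c k => [|c IHc] k ck kn /=; first by rewrite subn0.
rewrite dih_down // subSS.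
case: k ck kn => [|k] ck kn; first by case: c ck {IHc}.
have -> : dih_letter k.+2 = dih_letter k by rewrite /dih_letter /= negbK.
by rewrite IHc //; exact: ltnW.
Qed.

End Free.

Lemma dih_order : (1 < m)%N. Proof. exact: cox_offdiag ij Mij. Qed.

(** The coefficient vectors of the two roots are independent: their determinant is
    [U_(k'-k) > 0]. *)
Lemma dih_root_neq k k' y y' : (k < k' < m)%N ->
  emits_at (dih_root k) y -> emits_at (dih_root k') y' -> y <> y'.
Proof.
move=> /andP[kk' km] [_ E] [_ E'] yy'; case: mx => l xE _.
have := E (cox_act (rev l) (coord R i)); have := E (cox_act (rev l) (coord R j)).
rewrite yy' -!E' /dih_root xE !cox_actVK !coord_diag !coord_neq //; last by move/esym.
rewrite !mulr0 !mulr1 !add0r !addr0 => Ek Ek1.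
have := cheb_wronskian (coxcos R m) k (k' - k).
rewrite subnKC ?(ltnW kk') // Ek Ek1 mulrC subrr.
have : (0 < U (k' - k))%R by apply: cheb_gt0; lia.
by move=> + E0; rewrite -E0 ltxx.
Qed.

(* [U k' * root k] is the positive combination [U (k' - k) * root 0 + U k * root k'], whereas a
   simple root is no combination of a root of constant sign and another simple root. *)
Lemma dih_two_emits k k' : (k < k' < m)%N ->
  emits (dih_root k) -> emits (dih_root k') -> k = 0%N.
Proof.
move=> kk'm [y Ey] [y' Ey']; have yy' := dih_root_neq kk'm Ey Ey'.
case: (posnP k) => // k0; exfalso.
have Uk : (0 < U k)%R by apply: cheb_gt0; lia.
have Uk' : (0 < U k')%R by apply: cheb_gt0; lia.
have Ukk : (0 < U (k' - k))%R by apply: cheb_gt0; lia.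
have id_y f : (U k' * f y = U (k' - k) * x f i + U k * f y')%R.
  rewrite -(Ey.2 f) -(Ey'.2 f) /dih_root -(cheb_wronskian _ k (k' - k)).
  by rewrite subnKC; [ring|lia].
case: mx => l xE _; rewrite xE in id_y.
have [pos|neg] := pos_or_neg_root R M l i.
  have := id_y (coord R y'); rewrite coord_diag coord_neq; last by move/esym.
  by have := pos _ (coord_ge0 R y'); nra.
have := id_y (coord R y); rewrite coord_diag coord_neq //.
by have := neg _ (coord_ge0 R y); nra.
Qed.

(** The roots 0 and [m - 1] are those of [i] and [j], so every letter emits and the state stays put.
    The emitted generators have the form value of [i] and [j], hence the same label and a braid
    relation of their own. *)
Lemma dih_run_emits y y' h : emits_at (dih_root 0) y -> emits_at (dih_root m.-1) y' ->
  alt_iter m (retract_step i false) (retract_step j false) (x, h) =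
  alt_iter m (retract_step j false) (retract_step i false) (x, h).
Proof.
move=> Ey Ey'; have m1 := dih_order; have [U0 U1] := cheb_order R m1.
have yy' : y <> y' by apply: dih_root_neq Ey Ey'; lia.
have Ei : emits_at (fun f => x f i) y.
  by split=> [|f]; [exact: Ey.1|rewrite -(Ey.2 f) /dih_root cheb0 cheb1; ring].
have Ej : emits_at (fun f => x f j) y'.
  split=> [|f]; first exact: Ey'.1.
  rewrite -(Ey'.2 f) /dih_root prednK ?U0; last by lia.
  have -> : U m.-1 = 1%R by rewrite -subn1 cheb_sym ?cheb1 // ltnW.
  by ring.
have step k a b ya yb : emits_at (fun f => x f a) ya -> emits_at (fun f => x f b) yb ->
    alt_iter k (retract_step a false) (retract_step b false) (x, h) =
    (x, h * alt_prod k (val ya) (val yb)).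
  move=> Ea Eb; rewrite -alt_iter_mul.
  rewrite (@alt_iter_morph _ _ (fun h => (x, h)) k _ _
    (retract_step a false) (retract_step b false)) // => g.
    by rewrite (retract_emit _ _ Ea).
  by rewrite (retract_emit _ _ Eb).
rewrite !(step _ _ _ _ _ Ei Ej) !(step _ _ _ _ _ Ej Ei).
suff Myy' : M y y' = Some m by rewrite (artin_braid artin yy' Myy').
case: mx => l xE _.
have ay : cox_form R M y = cox_act (rev l) (cox_form R M i).
  rewrite -cox_act_gram; apply/funext => w; rewrite cox_formC.
  by rewrite -(Ei.2 (cox_form R M w)) xE.
have cE : cox_form R M y y' = cox_form R M i j.
  by rewrite -(Ej.2 (cox_form R M y)) xE ay cox_actVK.
have /andP[c0 c2] := coxcos_bounds R m1.
move: cE; rewrite /cox_form Mij /=; case E: (M y y') => [n|] /= cE; last by exfalso; lra.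
have n1 := cox_offdiag yy' E.
by congr Some; apply: (@coxcos_inj R); [lia|lia|apply: oppr_inj].
Qed.

End Dihedral.

(** The walks starting with [i] and with [j] meet the same [m] roots in opposite order, as
    [U_(m-k) = U_k]. *)
Lemma dih_root_swap i j m x k : i <> j -> M i j = Some m -> (k < m)%N ->
  dih_root j i m x k = dih_root i j m x (m - k.+1).
Proof.
move=> ij Mij km; have m1 := cox_offdiag ij Mij.
apply/funext => f; rewrite /dih_root cheb_sym // -(@cheb_sym R m k) //; last exact: ltnW.
have -> : (m - k.+1).+1 = (m - k)%N by lia.
by rewrite addrC.
Qed.

(* The walk emits when it meets the wall of the root [k] and then goes back. *)
Lemma retract_single i j m x h k : i <> j -> M i j = Some m -> min_rep x ->
  (k < m)%N -> (k.*2 < m)%N -> emits (dih_root i j m x k) ->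
  (forall k', (k' < m)%N -> k' <> k -> ~ emits (dih_root i j m x k')) ->
  run m (retract_step i false) (retract_step j false) (x, h) =
  run m (retract_step j false) (retract_step i false) (x, h).
Proof.
move=> ij Mij mx km k2m [y Ey] uniq.
have ji : j <> i by move/esym.
have Mji : M j i = Some m by rewrite cox_sym.
have free1 k' : (k' < k)%N -> ~ emits (dih_root i j m x k').
  by move=> lt; apply: uniq; lia.
have free2 k' : (k' < m - k.+1)%N -> ~ emits (dih_root j i m x k').
  by move=> lt; rewrite (dih_root_swap x ij Mij); [apply: uniq; lia|lia].
have emit1 : emits_at (fun f => dih_state i j x k f (dih_letter i j k)) y.
  by rewrite (dih_state_root x Mij).
have emit2 : emits_at (fun f => dih_state j i x (m - k.+1) f (dih_letter j i (m - k.+1))) y.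
  rewrite (dih_state_root x Mji) (dih_root_swap x ij Mij); last by lia.
  by have -> : (m - (m - k.+1).+1 = k)%N by lia.
pose r a b n := retract_step (dih_letter a b n) false.
have per a b n : r a b n.+2 = r a b n by rewrite /r /dih_letter /= negbK.
have down a b n c g : M a b = Some m -> (0 < n)%N -> (c <= n)%N ->
    (forall k', (k' < n)%N -> ~ emits (dih_root a b m x k')) ->
    run c (r a b n.+1) (r a b n.+2) (dih_state a b x n, g) = (dih_state a b x (n - c), g).
  case: n => // n Mab _ cn free; rewrite !per.
  exact: (dih_run_down Mab mx free).
have m1 := cox_offdiag ij Mij.
have runk g : run k (r i j k.+1) (r i j k.+2) (dih_state i j x k, g) = (x, g).
  by case: (posnP k) => [->//|k0]; rewrite down // subnn.
have up1 : run k (r i j 0) (r i j 1%N) (x, h) = (dih_state i j x k, h).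
  by rewrite (dih_run_up Mij free1).
have up2 n g : (n <= m - k.+1)%N ->
    run n (r j i 0) (r j i 1%N) (x, g) = (dih_state j i x n, g).
  by move=> le; rewrite (dih_run_up Mji free2).
have em1 g : r i j k (dih_state i j x k, g) = (dih_state i j x k, g * val y).
  exact: (retract_emit g false emit1).
have em2 g : r j i (m - k.+1)%N (dih_state j i x (m - k.+1), g) =
    (dih_state j i x (m - k.+1), g * val y).
  exact: (retract_emit g false emit2).
have -> : run m (retract_step i false) (retract_step j false) (x, h) =
    (dih_state j i x (m - k.*2.+1), h * val y).
  (* Up [k] steps to the wall, the emission, [k] steps back to [x], then [m - 2k - 1] steps in the
     other direction. *)
  have -> : m = (k + (1 + (k + (m - k.*2.+1))))%N by lia.
  rewrite -[retract_step i false]/(r i j 0) -[retract_step j false]/(r i j 1%N).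
  rewrite !(run_periodic _ _ _ _ (per i j)) /= up1 !add0n addn1 em1 runk.
  have -> : r i j (k.+1 + k) = r j i 0 by rewrite /r /dih_letter addSn /= addnn odd_double.
  have -> : r i j (k.+1 + k).+1 = r j i 1%N by rewrite /r /dih_letter addSn /= addnn odd_double.
  by rewrite up2; [congr (dih_state _ _ _ _, _)|]; lia.
(* Up [m - k - 1] steps to the same wall from the other side, the emission, then [k] steps back. *)
have -> : m = (m - k.+1 + (1 + k))%N by lia.
rewrite -[retract_step j false]/(r j i 0) -[retract_step i false]/(r j i 1%N).
rewrite !(run_periodic _ _ _ _ (per j i)) /= up2 // add0n addn1 em2 down //; [|lia|lia].
by congr (dih_state _ _ _ _, _); lia.
Qed.

(** If none of the [m] roots emits, both walks only move, and the braid relation of the linear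
    action applies. Two emitting roots are the first and the last; a single one is a wall met by
    both walks. *)
Lemma retract_braid i j m x h : i <> j -> M i j = Some m -> min_rep x ->
  alt_iter m (retract_step i false) (retract_step j false) (x, h) =
  alt_iter m (retract_step j false) (retract_step i false) (x, h).
Proof.
move=> ij Mij mx; have m1 := cox_offdiag ij Mij.
have ji : j <> i by move/esym.
have Mji : M j i = Some m by rewrite cox_sym.
have run_alt : run m (retract_step i false) (retract_step j false) (x, h) =
    run m (retract_step j false) (retract_step i false) (x, h) ->
    alt_iter m (retract_step i false) (retract_step j false) (x, h) =
    alt_iter m (retract_step j false) (retract_step i false) (x, h).
  by rewrite !alt_iter_run => ->; case: (odd m).
have [[k [km Ek]]|none] := pselect (exists k, (k < m)%N /\ emits (dih_root i j m x k)); last first.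
  have free1 k' : (k' < m)%N -> ~ emits (dih_root i j m x k').
    by move=> lt E; apply: none; exists k'.
  have free2 k' : (k' < m)%N -> ~ emits (dih_root j i m x k').
    by move=> lt; rewrite (dih_root_swap x ij Mij) //; apply: free1; lia.
  apply: run_alt.
  have /= -> := dih_run_up Mij free1 h (leqnn (0 + m)%N).
  have /= -> := dih_run_up Mji free2 h (leqnn (0 + m)%N).
  congr pair; apply/funext => f; rewrite /dih_state !rev_alt_seq.
  by case: (odd _); apply: cox_act_braid.
have swap k' : (k' < m)%N -> emits (dih_root i j m x k') ->
    emits (dih_root j i m x (m - k'.+1)).
  move=> lt; rewrite (dih_root_swap x ij Mij); last by lia.
  by have -> : (m - (m - k'.+1).+1 = k')%N by lia.
have two a b : (a < b < m)%N -> emits (dih_root i j m x a) -> emits (dih_root i j m x b) ->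
    alt_iter m (retract_step i false) (retract_step j false) (x, h) =
    alt_iter m (retract_step j false) (retract_step i false) (x, h).
  move=> abm Ea Eb.
  have a0 := dih_two_emits ij mx abm Ea Eb.
  have b1 : (m - b.+1 = 0)%N.
    have lt : (m - b.+1 < m - a.+1 < m)%N by lia.
    apply: (dih_two_emits ji mx lt); apply: swap => //; lia.
  have [y Ey] := Ea; have [y' Ey'] := Eb.
  rewrite a0 in Ey; have bE : b = m.-1 by lia.
  by rewrite bE in Ey'; exact: (dih_run_emits ij Mij mx h Ey Ey').
have [[k' [k'm k'k Ek']]|none] :=
    pselect (exists k', [/\ (k' < m)%N, k' <> k & emits (dih_root i j m x k')]).
  by case: (ltngtP k k') => lt; [apply: (two k k')|apply: (two k' k)|] => //; lia.
have uniq k' : (k' < m)%N -> k' <> k -> ~ emits (dih_root i j m x k').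
  by move=> lt ne E; apply: none; exists k'.
apply: run_alt; have [k2m|mk2] := ltnP k.*2 m.
  exact: (retract_single h ij Mij mx km).
(* A wall in the second half of the walk from [i] is in the first half of the walk from [j], at
   index [m - k - 1]. *)
symmetry; apply: (retract_single h ji Mji mx (k := (m - k.+1)%N)) => //; [lia|lia| |].
  exact: swap.
move=> k' lt ne; rewrite (dih_root_swap x ij Mij) //; apply: uniq; lia.
Qed.

Definition retract_state := {xh : (F -> F) * H | min_rep xh.1}.

Definition retract_act i b (z : retract_state) : retract_state :=
  exist _ (retract_step i b ((sval z).1, (sval z).2))
    (min_rep_step i b (sval z).2 (svalP z)).

Lemma sval_retract_act i b z : sval (retract_act i b z) = retract_step i b (sval z).
Proof. by case: z => [[x h] mx]. Qed.

Lemma retract_wval (w1 w2 : word I) (z : retract_state) :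
  word_val val w1 = word_val val w2 -> word_act retract_act w1 z = word_act retract_act w2 z.
Proof.
move=> E; apply: (artin_act artin _ _ E) => {z E}.
  move=> i b [[x h] mx]; apply: sval_inj; rewrite !sval_retract_act.
  exact: retract_stepK.
move=> i j m ij Mij z; apply: sval_inj.
rewrite !(@alt_iter_morph _ _ sval m _ _ _ _ z (sval_retract_act _ _) (sval_retract_act _ _)).
by case: z => [[x h] mx]; exact: retract_braid.
Qed.

Lemma sval_word_act w z :
  sval (word_act retract_act w z) = word_act retract_step w (sval z).
Proof.
by elim: w z => //= l w IHw z; rewrite IHw sval_retract_act.
Qed.

Lemma word_act_retract_in w h : word_in Y w ->
  word_act retract_step w (id, h) = (id, h * word_val val w).
Proof.
elim: w h => [|[i b] w IHw] h /=; first by rewrite mulg1.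
by move=> [Yi Yw]; rewrite (@retract_emit _ _ _ _ i) // IHw // mulgA.
Qed.

Lemma cox_act_coord_out (X : I -> Prop) l y i : (forall s, List.In s l -> X s) ->
  ~ X y -> X i -> cox_act l (coord R y) i = 0%R.
Proof.
move=> Xl nXy; have ne s : X s -> y <> s by move=> Xs E; apply: nXy; rewrite E.
move=> Xi; suff -> : cox_act l (coord R y) = coord R y by rewrite coord_neq //; exact: ne.
elim: l Xl => //= s l IHl Xl; rewrite IHl; last by move=> s' ?; apply: Xl; right.
apply/funext => j; rewrite /reflect [coord R y s]coord_neq ?mulr0 ?subr0 //.
by apply/ne/Xl; left.
Qed.

(** The state is a word in [X], so an emitted simple root lies in the span of [X], and its letter is
    in [X] as well as in [Y]. *)
Lemma word_act_retract_inI (X : I -> Prop) w l h : word_in X w ->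
  (forall s, List.In s l -> X s) ->
  exists l' w', word_act retract_step w (cox_act l, h) = (cox_act l', h * word_val val w') /\
    word_in (fun i => X i /\ Y i) w'.
Proof.
elim: w l h => [|[i b] w IHw] l h /=.
  by move=> _ _; exists l, [::]; rewrite mulg1.
move=> [Xi Xw] Xl; have [[y Ey]|ne] := pselect (emits (fun f => cox_act l f i)).
  have [l' [w' [E in_w']]] := IHw l (h * letter_val val (y, b)) Xw Xl.
  exists l', ((y, b) :: w'); rewrite (retract_emit _ _ Ey) E /= mulgA.
  split=> //; split=> //; split; last exact: Ey.1.
  have [//|nXy] := pselect (X y).
  have := Ey.2 (coord R y); rewrite coord_diag (cox_act_coord_out Xl nXy Xi) => /eqP.
  by rewrite eq_sym oner_eq0.
rewrite retract_move //; apply: (IHw (i :: l)) => // s [<-//|]; exact: Xl.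
Qed.

Lemma min_rep_id : min_rep id.
Proof. by exists [::] => // y _ f f0; exact: f0. Qed.

Theorem word_in_inter (X : I -> Prop) (w1 w2 : word I) : word_in X w1 -> word_in Y w2 ->
  word_val val w1 = word_val val w2 ->
  exists2 w, word_in (fun i => X i /\ Y i) w & word_val val w = word_val val w2.
Proof.
move=> X1 Y2 E.
pose z : retract_state := exist (fun xh : (F -> F) * H => min_rep xh.1) (id, 1) min_rep_id.
have := congr1 sval (retract_wval z E); rewrite !sval_word_act /=.
rewrite (word_act_retract_in 1 Y2) mul1g.
have [//|l' [w' [+ in_w']]] := @word_act_retract_inI X w1 [::] 1 X1.
by rewrite /= mul1g => -> -[_ <-]; exists w'.
Qed.

End Retraction.
End ArtinSystem.

(** * The amalgam along a pair with label infinity *)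

Section Generated.
Variables (I : Type) (H : groupType) (val : I -> H).
Implicit Types (Y X : I -> Prop) (g h : H).

Definition gen_by Y h := exists2 w, word_in Y w & word_val val w = h.

Lemma word_in_cat Y (u v : word I) : word_in Y (u ++ v) <-> word_in Y u /\ word_in Y v.
Proof. by elim: u => [|l u IHu] /=; [tauto|rewrite IHu; tauto]. Qed.

Lemma gen_by1 Y : gen_by Y 1.
Proof. by exists [::]. Qed.

Lemma gen_byM Y g h : gen_by Y g -> gen_by Y h -> gen_by Y (g * h).
Proof.
move=> [u Yu <-] [v Yv <-]; exists (u ++ v); last by rewrite word_val_cat.
exact/word_in_cat.
Qed.

Lemma word_in_inv Y (w : word I) : word_in Y w -> word_in Y (inv_word w).
Proof.
elim: w => //= -[x b] w IHw [Yx /IHw Yw].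
by rewrite /inv_word /= rev_cons -cats1; apply/word_in_cat.
Qed.

Lemma gen_byV Y h : gen_by Y h -> gen_by Y h^-1.
Proof.
by move=> [w Yw <-]; exists (inv_word w); [exact: word_in_inv|exact: word_val_inv].
Qed.

Lemma gen_by_letter Y i b : Y i -> gen_by Y (letter_val val (i, b)).
Proof. by move=> Yi; exists [:: (i, b)] => //; rewrite word_val1. Qed.

Lemma gen_by_sub Y X h : (forall i, Y i -> X i) -> gen_by Y h -> gen_by X h.
Proof. by move=> YX [w Yw <-]; exists w => //; elim: w Yw => //= l w IHw [/YX ? /IHw]. Qed.

Lemma gen_byMr Y g h : gen_by Y h -> gen_by Y (g * h) <-> gen_by Y g.
Proof.
move=> Yh; split=> [Ygh|Yg]; last exact: gen_byM.
by rewrite -(mulgK h g); apply: gen_byM => //; exact: gen_byV.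
Qed.

Lemma gen_byMl Y g h : gen_by Y h -> gen_by Y (h * g) <-> gen_by Y g.
Proof.
move=> Yh; split=> [Ygh|Yg]; last exact: gen_byM.
by rewrite -(mulKg h g); apply: gen_byM => //; exact: gen_byV.
Qed.

End Generated.

Section Amalgam.
Variables (R : realType) (I : Type) (M : coxeter_matrix I) (H : groupType) (val : I -> H).
Hypothesis artin : artin_system M val.
Local Notation gen := (gen_by val).
Implicit Types (g h x y c : H) (b : bool).

Lemma gen_by_inter X Y h : gen X h -> gen Y h -> gen (fun i => X i /\ Y i) h.
Proof.
move=> [u Xu Eu] [v Yv Ev]; have E : word_val val u = word_val val v by rewrite Eu.
by have [w XYw Ew] := word_in_inter R artin Xu Yv E; exists w; rewrite ?Ew.
Qed.

(** The exponent sum is well defined, since both sides of a braid relation have the same length. *)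
Lemma letter_exp_neq1 i n : word_val val (nseq n.+1 (i, false)) <> 1.
Proof.
move=> E; pose A (_ : I) (b : bool) (z : int) : int := (if b then z - 1 else z + 1)%R.
have /(_ 0%R) : forall z, word_act A (nseq n.+1 (i, false)) z = word_act A [::] z.
  apply: (artin_act artin) => //.
    by move=> j b z; rewrite /A; case: b => /=; rewrite ?addrK ?subrK.
have -> k (z : int) : word_act A (nseq k (i, false)) z = (z + k%:R)%R.
  by elim: k z => [|k IHk] z; rewrite ?addr0 //= IHk /A -natr1; ring.
by move=> /=; rewrite add0r => /eqP; rewrite pnatr_eq0.
Qed.

(** Otherwise the power would lie in the intersection of the parabolics of [{i}] and [Y], which is
    trivial. *)
Lemma letter_exp_out Y i n : ~ Y i -> ~ gen Y (word_val val (nseq n.+1 (i, false))).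
Proof.
move=> nYi Yg.
have Xg : gen (fun j => j = i) (word_val val (nseq n.+1 (i, false))).
  by exists (nseq n.+1 (i, false)) => //; elim: n.+1.
have [[|[j b] w] in_w E] := gen_by_inter Xg Yg; first exact: (@letter_exp_neq1 i n).
by case: in_w => -[/= ji Yj] _; apply: nYi; rewrite -ji.
Qed.

(** * Normal forms in the amalgam *)

Variables i0 j0 : I.
Hypothesis M_inf : M i0 j0 = None.

Definition excl b := if b then j0 else i0.
Definition side b := gen (fun i => i <> excl b).
Definition core := gen (fun i => i <> i0 /\ i <> j0).

Lemma core_side b c : core c -> side b c.
Proof. by apply: gen_by_sub => i []; case: b. Qed.

(** The choice is made from the coset as a set, so the result depends on the coset alone. *)
Definition coset_rep x : H := xget 1 [set y | core (x^-1 * y)].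

Lemma coset_repP x : core (x^-1 * coset_rep x).
Proof.
rewrite /coset_rep; apply: (@xgetPex _ 1 [set y | core (x^-1 * y)]).
by exists x => /=; rewrite mulVg; exact: gen_by1.
Qed.

Lemma coset_rep_eq x y : core (x^-1 * y) -> coset_rep x = coset_rep y.
Proof.
move=> cxy; rewrite /coset_rep; congr (xget 1); apply/funext => z /=; apply/propext.
have -> : x^-1 * z = x^-1 * y * (y^-1 * z) by rewrite !mulgA mulgK.
exact: gen_byMl.
Qed.

(* The state [(c, [:: (b_n, r_n); ...; (b_1, r_1)])] stands for the normal form
   [r_1 ... r_n c]. *)
Definition tree_state : Type := H * seq (bool * H).

Definition top_not b (l : seq (bool * H)) : Prop := if l is (b', _) :: _ then b' = ~~ b else True.

Fixpoint normal_list (l : seq (bool * H)) : Prop :=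
  if l is (b, r) :: l' then
    [/\ side b r, ~ core r, coset_rep r = r, top_not b l' & normal_list l']
  else True.

Definition normal_state (z : tree_state) : Prop := core z.1 /\ normal_list z.2.

Definition tree_split b (l : seq (bool * H)) : H * seq (bool * H) :=
  if l is (b', r) :: l' then if b' == b then (r, l') else (1, l) else (1, l).

Definition tree_push b y l : tree_state :=
  if pselect (core y) then (y, l) else ((coset_rep y)^-1 * y, (b, coset_rep y) :: l).

(** Right multiplication by an element of the factor [b]: the last syllable, if it is in that
    factor, is merged with the core part and [x], and the product is renormalised. *)
Definition tree_step b x (z : tree_state) : tree_state :=
  tree_push b ((tree_split b z.2).1 * z.1 * x) (tree_split b z.2).2.

Lemma tree_split_not b l : top_not b l -> tree_split b l = (1, l).
Proof. by case: l => [|[b' r] l] //= ->; case: b. Qed.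

Lemma tree_splitP b l : normal_list l -> side b (tree_split b l).1 /\
  top_not b (tree_split b l).2 /\ normal_list (tree_split b l).2.
Proof.
case: l => [|[b' r] l] /= => [_|[sr ncr rr tl nl]]; first by split=> //; exact: gen_by1.
case: eqP => [<-|ne] //=; split; first exact: gen_by1.
by split=> //; case: b b' ne {sr tl} => -[].
Qed.

Lemma normal_push b y l : side b y -> top_not b l -> normal_list l ->
  normal_state (tree_push b y l).
Proof.
move=> sy tl nl; rewrite /tree_push; case: pselect => [cy|ncy]; first by [].
have cr := coset_repP y.
have rE : coset_rep y = y * (y^-1 * coset_rep y) by rewrite mulVKg.
split=> /=; first by rewrite -[X in core X]invgK invgM invgK; exact: gen_byV.
split=> //.
- by rewrite rE; apply: gen_byM => //; exact: core_side.
- by rewrite rE => /(gen_byMr _ cr).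
- by rewrite -(coset_rep_eq cr).
Qed.

Lemma normal_step b x z : side b x -> normal_state z -> normal_state (tree_step b x z).
Proof.
move=> sx [cz nz]; have [sr [tl nl]] := tree_splitP b nz.
apply: normal_push => //; apply: gen_byM => //; apply: gen_byM => //.
exact: core_side.
Qed.

Lemma tree_step_push b x y l : top_not b l ->
  tree_step b x (tree_push b y l) = tree_push b (y * x) l.
Proof.
move=> tl; rewrite {1}/tree_push; case: (pselect (core y)) => cy.
  by rewrite /tree_step (tree_split_not tl) mul1g.
by rewrite /tree_step /= eqxx /= mulVKg.
Qed.

Lemma tree_stepM b x y z : normal_state z ->
  tree_step b y (tree_step b x z) = tree_step b (x * y) z.
Proof.
move=> [_ nz]; have [_ [tl _]] := tree_splitP b nz.
by rewrite [tree_step b x z]/tree_step tree_step_push // /tree_step !mulgA.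
Qed.

(** The actions of the two factors agree on the core, which is what gluing them requires. *)
Lemma tree_step_core b x z : core x -> normal_state z -> tree_step b x z = (z.1 * x, z.2).
Proof.
case: z => c l cx [/= cc nl].
have not_top : top_not b l -> tree_step b x (c, l) = (c * x, l).
  move=> tl; rewrite /tree_step tree_split_not //= mul1g /tree_push.
  by case: pselect => // -[]; exact: gen_byM.
case: l nl not_top => [|[b' r] l] /= nl not_top; first exact: not_top.
have [Eb|ne] := eqVneq b' b; last by apply: not_top; case: b b' ne {nl} => -[].
rewrite {}Eb {b' not_top} in nl *; have [sr ncr rr tl nl'] := nl.
rewrite /tree_step /= eqxx /= /tree_push -mulgA.
have ccx : core (c * x) by exact: gen_byM.
case: pselect => [/(gen_byMr _ ccx)//|ncy].
rewrite -(@coset_rep_eq r); last by rewrite mulKg.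
by rewrite rr mulKg.
Qed.

Lemma tree_step1 b z : normal_state z -> tree_step b 1 z = z.
Proof.
by move=> nz; rewrite tree_step_core ?mulg1 //; [case: z nz|exact: gen_by1].
Qed.

Definition letter_side k : bool := if pselect (k = j0) then false else true.

Lemma letter_side_gen k e : side (letter_side k) (letter_val val (k, e)).
Proof.
apply: gen_by_letter; rewrite /letter_side; case: pselect => //= ->.
by move=> E; move: M_inf; rewrite E cox_diag.
Qed.

Definition tree_letter k e (z : tree_state) : tree_state :=
  tree_step (letter_side k) (letter_val val (k, e)) z.

Lemma tree_letter_side b k e z : k <> excl b -> normal_state z ->
  tree_letter k e z = tree_step b (letter_val val (k, e)) z.
Proof.
rewrite /tree_letter /letter_side => kb nz; case: pselect => kj.
  by case: b kb.
case: b kb => // ki; rewrite !tree_step_core //; exact: gen_by_letter.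
Qed.

Lemma side_alt b k x y : side b x -> side b y -> side b (alt_prod k x y).
Proof.
elim: k x y => [|k IHk] x y sx sy; first exact: gen_by1.
by rewrite alt_prodS; apply: gen_byM => //; exact: IHk.
Qed.

Lemma tree_letter_alt b m k k' z : k <> excl b -> k' <> excl b -> normal_state z ->
  alt_iter m (tree_letter k false) (tree_letter k' false) z =
  tree_step b (alt_prod m (val k) (val k')) z.
Proof.
move=> kb kb' nz; have sv i : i <> excl b -> side b (val i).
  by move=> ib; exact: (gen_by_letter val false ib).
elim: m k k' kb kb' => [|m IHm] k k' kb kb'; first by rewrite tree_step1.
have sm := side_alt m (sv _ kb') (sv _ kb).
rewrite /= IHm // (@tree_letter_side b) //; last exact: normal_step.
by rewrite tree_stepM.
Qed.

Definition tree := {z | normal_state z}.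

Definition tree_act k e (z : tree) : tree :=
  exist _ (tree_letter k e (sval z)) (normal_step (letter_side_gen k e) (svalP z)).

Lemma tree_act_wval (u v : word I) (z : tree) : word_val val u = word_val val v ->
  word_act tree_act u z = word_act tree_act v z.
Proof.
move=> E; apply: (artin_act artin _ _ E) => {z E}.
  move=> k e [z nz]; apply: sval_inj; rewrite /= /tree_letter tree_stepM //.
  have -> : letter_val val (k, e) * letter_val val (k, ~~ e) = 1.
    by case: e; rewrite /letter_val /= ?mulVg ?mulgV.
  exact: tree_step1.
move=> k k' m kk' Mkk' z; apply: sval_inj.
have sval_alt a a' : sval (alt_iter m (tree_act a false) (tree_act a' false) z) =
    alt_iter m (tree_letter a false) (tree_letter a' false) (sval z).
  exact: alt_iter_morph.
rewrite !sval_alt.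
(* As [{i0, j0}] has label infinity, the two letters of a braid relation lie in a common factor. *)
have [b [kb kb']] : exists b, k <> excl b /\ k' <> excl b.
  have [kj|kj] := pselect (k = j0).
    exists false; split=> /= E; first by move: M_inf; rewrite -E kj cox_diag.
    by move: Mkk'; rewrite kj E cox_sym M_inf.
  have [kj'|kj'] := pselect (k' = j0); last by exists true.
  exists false; split=> /= E; first by move: Mkk'; rewrite kj' E M_inf.
  by move: M_inf; rewrite -E kj' cox_diag.
have nz := svalP z; rewrite !(@tree_letter_alt b) //.
by rewrite (artin_braid artin kk' Mkk').
Qed.

(** A group element acts through any word representing it. The relation avoids choosing one, and is
    functional by [tree_trans_uniq]. *)
Definition tree_trans (z : tree_state) h (z' : tree_state) :=
  normal_state z /\ exists2 w, word_val val w = h & word_act tree_letter w z = z'.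

Lemma sval_tree_act w z : sval (word_act tree_act w z) = word_act tree_letter w (sval z).
Proof. by elim: w z => //= l w IHw z; rewrite IHw. Qed.

Lemma tree_trans_normal z h z' : tree_trans z h z' -> normal_state z'.
Proof.
move=> [nz [w _ <-]]; have := sval_tree_act w (exist _ z nz) => /= <-.
exact: svalP.
Qed.

Lemma tree_trans_uniq z h z1 z2 : tree_trans z h z1 -> tree_trans z h z2 -> z1 = z2.
Proof.
move=> [nz [u Eu <-]] [_ [v Ev <-]].
rewrite -!(sval_tree_act _ (exist _ z nz)); congr sval.
by apply: tree_act_wval; rewrite Eu.
Qed.

Lemma tree_transM z g h z1 z2 : tree_trans z g z1 -> tree_trans z1 h z2 ->
  tree_trans z (g * h) z2.
Proof.
move=> [nz [u <- <-]] [_ [v <- <-]]; split=> //.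
by exists (u ++ v); [rewrite word_val_cat|rewrite word_act_cat].
Qed.

Lemma tree_trans_side b x z : side b x -> normal_state z -> tree_trans z x (tree_step b x z).
Proof.
move=> [w sw <-] nz; split=> //; exists w => //.
elim: w z sw nz => [|[k e] w IHw] z /=; first by move=> _ nz; rewrite tree_step1.
move=> [kb sw] nz; rewrite (@tree_letter_side b) // IHw //; last first.
  by apply: normal_step => //; exact: gen_by_letter.
by rewrite tree_stepM.
Qed.

(* [red a b k h]: [h] is a reduced product of [k] syllables of alternating sides, the first
   of side [a] and the last of side [b]. *)
Inductive red : bool -> bool -> nat -> H -> Prop :=
| red1 b x of side b x & ~ core x : red b b 1%N x
| redS a b k g x of red a b k g & side (~~ b) x & ~ core x : red a (~~ b) k.+1 (g * x).

Lemma red_gen a b k h : red a b k h -> gen (fun=> True) h.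
Proof.
elim=> [{}b x sx _|{}a {}b {}k g x _ IH sx _]; first exact: gen_by_sub sx.
by apply: gen_byM => //; exact: gen_by_sub sx.
Qed.

Lemma red_cat a b d k l g h : red a b k g -> red (~~ b) d l h -> red a d (k + l) (g * h).
Proof.
move=> rg; move Eb: (~~ b) => b' rh; elim: rh Eb => [{}d x sx ncx|{}b' {}d {}l h' x rh' IH sx ncx] Eb.
  by rewrite addn1 -Eb; apply: redS; rewrite ?Eb.
by rewrite mulgA addnS; apply: redS => //; exact: IH.
Qed.

Lemma core_inv x : core x^-1 -> core x.
Proof. by move/gen_byV; rewrite invgK. Qed.

Lemma red_inv a b k g : red a b k g -> red b a k g^-1.
Proof.
elim=> [{}b x sx ncx|{}a {}b {}k {}g x _ IH sx ncx].
  by apply: red1; [exact: gen_byV|move=> /core_inv].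
rewrite invgM -add1n; apply: (@red_cat _ (~~ b)); last by rewrite negbK; exact: IH.
by apply: red1; [exact: gen_byV|move=> /core_inv].
Qed.

Lemma red_mul_core a b k g c : core c -> red a b k g -> red a b k (g * c).
Proof.
move=> cc [{}b x sx ncx|{}a {}b {}k {}g x rg sx ncx].
  apply: red1; first by apply: gen_byM => //; exact: core_side.
  by move=> /(gen_byMr _ cc).
rewrite -mulgA; apply: redS => //; first by apply: gen_byM => //; exact: core_side.
by move=> /(gen_byMr _ cc).
Qed.

Lemma red_mul_side a b k g x : side b x -> red a b k g ->
  core (g * x) \/ exists b' k', red a b' k' (g * x).
Proof.
move=> + rg; case: rg => [{}b y sy ncy|{}a {}b {}k {}g y rg sy ncy] sx.
  have [|ncyx] := pselect (core (y * x)); first by left.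
  by right; exists b, 1%N; apply: red1 => //; exact: gen_byM.
right; rewrite -mulgA; have [cyx|ncyx] := pselect (core (y * x)).
  by exists b, k; exact: red_mul_core.
by exists (~~ b), k.+1; apply: redS => //; exact: gen_byM.
Qed.

Lemma red_ex h : gen (fun=> True) h -> ~ core h -> exists a b k, red a b k h.
Proof.
move=> [w _ <-] nc; suff: core (word_val val w) \/ exists a b k, red a b k (word_val val w).
  by case.
elim/last_ind: w {nc} => [|w [k e] IHw]; first by left; exact: gen_by1.
rewrite -cats1 word_val_cat word_val1; move: (word_val val w) IHw => g.
have := letter_side_gen k e; move: (letter_side k) (letter_val val (k, e)) => b x sx {w k e}.
move=> [cg|[a [b' [k rg]]]].
  have [|ncgx] := pselect (core (g * x)); first by left.
  right; exists b, b, 1%N; apply: red1 => //; apply: gen_byM => //; exact: core_side.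
have [Eb|ne] := eqVneq b' b.
  rewrite Eb in rg; have [|[b'' [k' rk]]] := red_mul_side sx rg; first by left.
  by right; exists a, b'', k'.
have Eb : b = ~~ b' by case: b b' ne {rg sx} => -[].
right; have [cx|ncx] := pselect (core x).
  by exists a, b', k; exact: red_mul_core.
by exists a, (~~ b'), k.+1; apply: redS => //; rewrite -Eb.
Qed.

Lemma red_first a b k g : red a b k g ->
  exists x g' k', [/\ g = x * g', side a x, ~ core x, k = k'.+1 &
    [/\ k' = 0%N, g' = 1 & a = b] \/ red (~~ a) b k' g'].
Proof.
elim=> [{}b x sx ncx|{}a {}b {}k {}g x rg [y [g' [k' [-> sy ncy -> IH]]]] sx ncx].
  by exists x, 1, 0%N; rewrite mulg1; split=> //; left.
exists y, (g' * x), k'.+1; rewrite mulgA; split=> //; right.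
case: IH => [[-> -> ->]|rg']; last exact: redS.
by rewrite mul1g; exact: red1.
Qed.

Lemma tree_step_size b x z : (size (tree_step b x z).2 <= (size z.2).+1)%N.
Proof.
rewrite /tree_step /tree_push; case: z => c l /=.
have : (size (tree_split b l).2 <= size l)%N by case: l => [|[b' r] l] //=; case: (b' == b) => /=.
by case: (pselect _) => cy /=; [exact: leqW|].
Qed.

Lemma tree_step_size_top b x z l r : z.2 = (b, r) :: l ->
  (size (tree_step b x z).2 <= size z.2)%N.
Proof.
rewrite /tree_step /tree_push; case: z => c _ /= ->.
by rewrite /= eqxx; case: (pselect _) => cy /=.
Qed.

Lemma tree_step_new b x z : side b x -> ~ core x -> normal_state z -> top_not b z.2 ->
  exists c r, tree_step b x z = (c, (b, r) :: z.2).
Proof.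
case: z => c l sx ncx [/= cc _] tl; rewrite /tree_step /= tree_split_not //= mul1g.
rewrite /tree_push; case: (pselect (core (c * x))) => [/(gen_byMl _ cc)//|ncx'].
by eexists; eexists.
Qed.

Lemma red_trans_size a b k g z z' : red a b k g -> tree_trans z g z' ->
  (size z'.2 <= size z.2 + k)%N.
Proof.
move=> rg; elim: rg z z' => [{}b x sx ncx|{}a {}b {}k {}g x rg IH sx ncx] z z' tz.
  have -> := tree_trans_uniq tz (tree_trans_side sx tz.1).
  by rewrite addn1; exact: tree_step_size.
have [w [Ew]] : exists w, word_val val w = g by case: (red_gen rg) => w _ <-; exists w.
have t1 : tree_trans z g (word_act tree_letter w z) by split; [exact: tz.1|exists w].
have t2 := tree_transM t1 (tree_trans_side sx (tree_trans_normal t1)).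
rewrite (tree_trans_uniq tz t2) addnS; apply: leq_trans (tree_step_size _ _ _) _.
by rewrite ltnS; exact: IH.
Qed.

(** Each syllable meets a top of the other side, so none is absorbed and the normal form grows by
    exactly [k]. *)
Lemma red_trans a b k g z : red a b k g -> normal_state z -> top_not a z.2 ->
  exists c r l, [/\ tree_trans z g (c, (b, r) :: l) & size ((b, r) :: l) = (size z.2 + k)%N].
Proof.
move=> rg nz tz; elim: rg tz => [{}b x sx ncx|{}a {}b {}k {}g x rg IH sx ncx] tz.
  have [c [r E]] := tree_step_new sx ncx nz tz.
  by exists c, r, z.2; split; [rewrite -E; exact: tree_trans_side|rewrite addn1].
have [c [r [l [t1 sz]]]] := IH tz.
have n1 := tree_trans_normal t1.
have top1 : top_not (~~ b) (c, (b, r) :: l).2 by rewrite /= negbK.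
have [c' [r' E]] := tree_step_new sx ncx n1 top1.
exists c', r', ((b, r) :: l); split; last by rewrite addnS -sz.
by rewrite -E; apply: tree_transM t1 _; exact: tree_trans_side.
Qed.

Definition root_state : tree_state := (1, [::]).

Lemma normal_root : normal_state root_state.
Proof. by split=> //; exact: gen_by1. Qed.

Lemma core_letter_out b n : ~ core (word_val val (nseq n.+1 (excl b, false))).
Proof. by apply: letter_exp_out; case: b => -[]. Qed.

Lemma i0_neq_j0 : i0 <> j0.
Proof. by move=> E; move: M_inf; rewrite E cox_diag. Qed.

(** With [q = val j0] and [p = q h q^-1], the product [q h = p q] is reduced of length 2 and ends in
    [side true]. Read as [p q], it ends in [side false], or has length at most 1 if [p] is in the
    core. *)
Lemma conj_letter_side h : side true h -> ~ core h -> side true (val j0 * h * (val j0)^-1) ->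
  False.
Proof.
move=> sh nch; set p := _ * _; set q := val j0 => sp.
have sq : side false q.
  by apply: (gen_by_letter val false) => /esym; exact: i0_neq_j0.
have ncq : ~ core q by have := @core_letter_out true 0; rewrite /= mulg1.
have rqh : red false (~~ false) 2 (q * h) by apply: redS => //; exact: red1.
have [c [r [l [t1 sz]]]] := red_trans rqh normal_root Logic.I.
have qhE : q * h = p * q by rewrite /p mulgVK.
rewrite qhE in t1; have [cp|ncp] := pselect (core p).
  have t2 := tree_transM (tree_trans_side sp normal_root)
    (tree_trans_side sq (normal_step sp normal_root)).
  have /= := tree_step_size false q (tree_step true p root_state).
  rewrite -(tree_trans_uniq t1 t2) /= tree_step_core //; last exact: normal_root.
  by move: sz; rewrite /= => ->.
have rpq : red true (~~ true) 2 (p * q) by apply: redS => //; exact: red1.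
have [c' [r' [l' [t2 _]]]] := red_trans rpq normal_root Logic.I.
by have [] := tree_trans_uniq t1 t2.
Qed.

(** * Commuting normal subgroups of the amalgam *)

Definition normal_subgroup (A : H -> Prop) :=
  [/\ forall x, A x -> gen (fun=> True) x,
      forall x y, A x -> A y -> A (x * y),
      forall x, A x -> A x^-1
    & forall g x, gen (fun=> True) g -> A x -> A (g * x * g^-1)].

Lemma side_gen b x : side b x -> gen (fun=> True) x.
Proof. exact: gen_by_sub. Qed.

Lemma letter_excl b : side (~~ b) (val (excl b)) /\ ~ core (val (excl b)).
Proof.
split; last by have := @core_letter_out b 0; rewrite /= mulg1.
apply: (gen_by_letter val false); case: b => /=; last exact: i0_neq_j0.
by move=> /esym; exact: i0_neq_j0.
Qed.

(** If both ends of [a] lie in one factor, multiplying by the conjugate of [a] under a letter of the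
    other factor corrects them; if the ends are reversed, inversion does. *)
Lemma red_true_false A a : normal_subgroup A -> A a -> ~ core a ->
  exists a' k, A a' /\ red true false k a'.
Proof.
move=> [AN AM AV AJ] Aa nca.
have [s [t [k ra]]] := red_ex (AN _ Aa) nca.
have [/= sq ncq] := letter_excl true; set q := val j0 in sq ncq.
have [/= sp ncp] := letter_excl false; set p := val i0 in sp ncp.
have rq := red1 sq ncq; have rp := red1 sp ncp.
case: s t ra => -[] ra.
- exists (a * (q * a * q^-1)); eexists; split.
    by apply: AM => //; apply: AJ => //; exact: side_gen sq.
  apply: (red_cat ra); apply: (@red_cat _ true); last exact: red_inv rq.
  exact: (red_cat rq ra).
- by exists a, k.
- by exists a^-1, k; split; [exact: AV|exact: red_inv].
- exists ((p * a * p^-1) * a); eexists; split.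
    by apply: AM => //; apply: AJ => //; exact: side_gen sp.
  apply: (@red_cat _ true); last exact: ra.
  apply: (@red_cat _ false); last exact: red_inv rp.
  exact: (red_cat rp ra).
Qed.

(* If neither subgroup fixes the base edge of the Bass-Serre tree, some [a] and [b] are
   reduced of types P...Q and P...P; then [a b] has length [l(a) + l(b)], whereas [b a]
   is shorter. *)
Lemma commuting_core A B (a b : H) : normal_subgroup A -> normal_subgroup B ->
  (forall x y, A x -> B y -> x * y = y * x) ->
  A a -> B b -> ~ core a -> core b.
Proof.
move=> nA nB comm Aa Bb nca; have [//|ncb] := pselect (core b); exfalso.
have [a1 [k [Aa1 ra1]]] := red_true_false nA Aa nca.
have [b1 [k' [Bb1 rb1]]] := red_true_false nB Bb ncb.
have [x [b2 [k2 [b1E sx ncx kE rb2]]]] := red_first rb1.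
have {}rb2 : red false false k2 b2 by case: rb2 => // -[].
have [/= sp ncp] := letter_excl false.
(* Conjugation by [p] should bring the last syllable to [side true] without absorbing the first
   syllable [x]: [i0] does this, or its square when [i0 x] is in the core. *)
have [p [{}sp {}ncp ncpx]] : exists p, [/\ side true p, ~ core p & ~ core (p * x)].
  have [cpx|ncpx] := pselect (core (val i0 * x)); last by exists (val i0).
  exists (val i0 * val i0); split; first exact: gen_byM.
    by have := @core_letter_out false 1; rewrite /= mulg1.
  by rewrite -mulgA => /(gen_byMr _ cpx).
have Bb3 : B (p * b1 * p^-1) by case: nB => _ _ _; apply=> //; exact: side_gen sp.
have rb3 : red true true (1 + k2 + 1) (p * b1 * p^-1).
  rewrite b1E mulgA; apply: (@red_cat _ false); last exact: red_inv (red1 sp ncp).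
  by apply: (@red_cat _ true) => //; apply: red1 => //; exact: gen_byM.
move: rb3 (comm _ _ Aa1 Bb3); move: (_ + _)%N (p * _ * _) => l g rg ag.
have [c [r [t [t1 sz1]]]] := red_trans (red_cat ra1 rg) normal_root Logic.I.
have [c' [r' [t' [t2 sz2]]]] := red_trans rg normal_root Logic.I.
have [y [a2 [k3 [a1E sy ncy k1E ra2]]]] := red_first ra1.
have {}ra2 : red false false k3 a2 by case: ra2 => // -[].
(* The last syllable of [g] and the first of [a1] are both in [side true]. They merge, so [g a1] is
   shorter than [a1 g]. *)
have t3 := tree_trans_side sy (tree_trans_normal t2).
have [w [Ew]] : exists w, word_val val w = a2 by case: (red_gen ra2) => w _ <-; exists w.
have t4 : tree_trans (tree_step true y (c', (true, r') :: t')) a2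
    (word_act tree_letter w (tree_step true y (c', (true, r') :: t'))).
  by split; [exact: tree_trans_normal t3|exists w].
have t5 := tree_transM t2 (tree_transM t3 t4).
rewrite -a1E -ag in t5.
have := red_trans_size ra2 t4; rewrite -(tree_trans_uniq t1 t5).
have := @tree_step_size_top true y (c', (true, r') :: t') t' r' erefl.
by move: sz1 sz2; rewrite /= k1E; lia.
Qed.

End Amalgam.

(** * Indecomposability *)

Section Indecomposable.
Variables (R : realType) (S : choiceType) (M : coxeter_matrix S).
Local Notation G := (virtual_artin M).
Local Notation Idx := (Idx R M).
Local Notation ival := (@ival R S M).
Local Notation idx := (@idx R S M).
Local Notation ind_matrix := (ind_matrix R M).
Local Notation gen := (gen_by ival).
Local Notation va_proj := (@va_proj S M).
Implicit Types (g h : G) (i j : Idx) (s t : S).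

Lemma va_artin : artin_system ind_matrix ival.
Proof. by split; [exact: ival_braid|exact: wval_act]. Qed.

Lemma gen_ker g : gen (fun=> True) g <-> va_proj g = 1.
Proof.
split=> [[x _ <-]|/(ker_va_proj R)[x ->]]; first exact: va_proj_wval.
by exists x => //; elim: x.
Qed.

(** * Supports of normal subgroups *)

Definition va_normal (A : G -> Prop) :=
  [/\ forall x, A x -> gen (fun=> True) x,
      forall x y, A x -> A y -> A (x * y),
      forall x, A x -> A x^-1
    & forall g x, A x -> A (g * x * g^-1)].

Lemma va_normal_subgroup A : va_normal A -> normal_subgroup ival A.
Proof. by move=> [AN AM AV AJ]; split=> // g x _; exact: AJ. Qed.

Lemma gen_shift (Y : Idx -> Prop) w g : gen (fun i => Y (ishift w i)) g ->
  gen Y (va_proj w * g * (va_proj w)^-1).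
Proof.
move=> [x Yx <-]; exists (shift_word w x); last exact: wval_shift.
by elim: x Yx => //= l x IHx [? /IHx].
Qed.

(** A word has finitely many letters. An element of all the parabolics omitting one letter would,
    after finitely many intersections, be generated by no letter at all. *)
Lemma gen_out_ex g : gen (fun=> True) g -> g <> 1 -> exists i, ~ gen (fun j => j <> i) g.
Proof.
move=> [x _ xE] g1; apply: contrapT => /forallNP out; apply: g1.
pose L := [seq l.1 | l <- x].
have inL : gen (fun i => List.In i L) g.
  exists x => //; rewrite /L.
  suff: forall L', (forall i, List.In i [seq l.1 | l <- x] -> List.In i L') ->
      word_in (fun i => List.In i L') x by apply.
  elim: x {xE L} => //= l x IHx L' sub; split; first by apply: sub; left.
  by apply: IHx => i ?; apply: sub; right.
have {}out i : gen (fun j => j <> i) g by apply: contrapT; exact: out.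
have remove L' : gen (fun i => List.In i L /\ ~ List.In i L') g.
  elim: L' => [|i L' IH]; first by apply: gen_by_sub inL => i ?; split.
  have := gen_by_inter R va_artin IH (out i); apply: gen_by_sub => j [[? nL'] ne]; split=> //=.
  by case=> [ij|//]; apply: ne.
by have [[|l y] //= [[]]] := remove L.
Qed.

Definition supports (A : G -> Prop) i := exists2 a, A a & ~ gen (fun j => j <> i) a.

Lemma supports_shift A w i : va_normal A -> supports A i -> supports A (ishift w i).
Proof.
move=> [_ _ _ AJ] [a Aa nga]; exists (va_proj w * a * (va_proj w)^-1); first exact: AJ.
move=> ga; apply: nga.
have -> : a = va_proj w^-1 * (va_proj w * a * (va_proj w)^-1) * (va_proj w^-1)^-1.
  by rewrite !va_projV invgK !mulgA mulVg mul1g mulgVK.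
apply: gen_shift; apply: gen_by_sub ga => j ne E; apply: ne.
by rewrite -E ishiftVK.
Qed.

Lemma supports_idx A u v s : va_normal A -> supports A (idx u s) -> supports A (idx v s).
Proof.
move=> nA /(supports_shift (v * u^-1) nA).
by rewrite ishift_idx mulgVK.
Qed.

(** If [A] lay in the parabolic omitting [j], so would the conjugates of its elements by [j], which
    the amalgam forbids outside the core. *)
Lemma supports_inf A i j : va_normal A -> ind_matrix i j = None ->
  supports A i -> supports A j.
Proof.
move=> [_ _ _ AJ] Mij [a Aa nga]; apply: contrapT => nsup.
have side_j x : A x -> side ival i j true x.
  by move=> Ax; apply: contrapT => ngx; apply: nsup; exists x.
apply: (conj_letter_side R va_artin Mij (side_j _ Aa)); last exact/side_j/AJ.
by move=> ca; apply: nga; apply: gen_by_sub ca => k [].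
Qed.

(** Normality in G carries the support along orbits of W, in particular from [alpha_s] to its
    opposite. The label infinity of [-alpha_s] and [alpha_t] carries it across an edge. *)
Lemma supports_full A i : coxeter_connected M -> va_normal A -> (exists2 a, A a & a <> 1) ->
  supports A i.
Proof.
move=> conn nA [a Aa a1]; have [AN _ _ _] := nA.
have [j nga] := gen_out_ex (AN _ Aa) a1.
have sj : supports A j by exists a.
have [u [s jE]] := idxP j; have [v [t ->]] := idxP i.
rewrite {}jE in sj; have [p path_p last_p] := conn s t.
rewrite -last_p; apply: (@supports_idx A 1) => //.
elim: p s {last_p} u sj path_p {nga j} => [|s' p IHp] s u sj /=.
  by move=> _; exact: supports_idx sj.
move=> /andP[edge]; apply: (IHp _ 1).
apply: supports_inf (ind_m_edge R 1 edge) _ => //.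
exact: supports_idx sj.
Qed.

(** For the pair of a root and its opposite, two nontrivial subgroups would both have elements
    outside the core, against [commuting_core]. *)
Lemma commuting_normal A B : coxeter_connected M -> va_normal A -> va_normal B ->
  (forall x y, A x -> B y -> x * y = y * x) ->
  (forall a, A a -> a = 1) \/ (forall b, B b -> b = 1).
Proof.
move=> conn nA nB comm.
have [|/existsNP[a /not_implyP[Aa a1]]] := pselect (forall a, A a -> a = 1); first by left.
right=> b Bb; apply: contrapT => b1.
have [AN _ _ _] := nA; have [i _] := gen_out_ex (AN _ Aa) a1.
have [u [s _]] := idxP i; pose i0 := idx 1 s; pose j0 := idx (1 * vtau M s) s.
have Minf : ind_matrix i0 j0 = None by exact: ind_m_opp.
have [a' Aa' nga'] : supports A i0 by apply: supports_full => //; exists a.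
have [b' Bb' ngb'] : supports B i0 by apply: supports_full => //; exists b.
have nca : ~ core ival i0 j0 a' by move=> ca; apply: nga'; apply: gen_by_sub ca => k [].
apply: ngb'; have := commuting_core R va_artin Minf (va_normal_subgroup nA)
  (va_normal_subgroup nB) comm Aa' Bb' nca.
by apply: gen_by_sub => k [].
Qed.

Lemma cox_eq_vtau (l l' : seq S) (h : G) : cox_eq M l l' ->
  foldr (fun s g => g * vtau M s) h l = foldr (fun s g => g * vtau M s) h l'.
Proof.
have foldr_alt k s t g : foldr (fun s g => g * vtau M s) g (alt_seq k s t) =
    alt_iter k ( *%g^~ (vtau M s)) ( *%g^~ (vtau M t)) g.
  by elim: k s t => //= k IHk s t; rewrite IHk.
move=> e; elim: e h => {l l'} //.
- by move=> s h; rewrite /= -mulgA vtau2 mulg1.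
- by move=> s t m st Mst h; rewrite !foldr_alt !alt_iter_mul (vtau_braid st Mst).
- by move=> l l' l'' _ IH1 _ IH2 h; rewrite IH1 IH2.
- by move=> l1 l1' l2 l2' _ IH1 _ IH2 h; rewrite !foldr_cat IH2 IH1.
Qed.

Lemma va_lin_trivial g : (forall (f : S -> R) s, va_lin g f s = f s) -> va_proj g = 1.
Proof.
move=> lin_id; have [l [-> El]] := va_proj_seq R g.
rewrite -[l in LHS]revK foldl_rev (@cox_eq_vtau _ [::]) //; apply: (@cox_act_pos_trivial R) => s.
by rewrite -El lin_id ltr01.
Qed.

(** * The centraliser of the kernel *)

Section Centralizer.
Variable k : G.
Hypothesis k_cent : forall n, gen (fun=> True) n -> k * n = n * k.

(** With [w = va_proj k], the element [n = k w^-1] lies in the kernel. As [k] centralises the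
    kernel, [n] conjugates the generator of [w i] to that of [i]; in the geometric representation it
    intertwines the two reflections. *)
Lemma cent_reflections : exists l : seq Idx, forall i f,
  reflect ind_matrix (ishift (va_proj k) i) (cox_act ind_matrix l f) =
  cox_act ind_matrix l (reflect ind_matrix i f) :> (Idx -> R).
Proof.
have [x xE] : exists x : word Idx, k * (va_proj k)^-1 = word_val ival x.
  by apply: ker_va_proj; rewrite va_projM va_projV va_projK mulgV.
pose A i (_ : bool) (f : Idx -> R) := reflect ind_matrix i f.
have word_actE y f : word_act A y f = cox_act ind_matrix (rev [seq l.1 | l <- y]) f.
  elim: y f => // l y IHy f.
  by rewrite /= rev_cons -cats1 cox_act_cat IHy.
exists (rev [seq l.1 | l <- x]) => i f; rewrite -!word_actE.
have := @artin_act _ _ _ _ va_artin _ A _ _ (x ++ [:: (ishift (va_proj k) i, false)])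
  ((i, false) :: x) _ f; rewrite word_act_cat /=; apply.
- by move=> j b g; exact: reflectK.
- move=> j j' m jj' Mjj' g; have alt_reflect n a b (f' : Idx -> R) :
      alt_iter n (A a false) (A b false) f' = cox_act ind_matrix (alt_seq n a b) f'.
    by elim: n a b => //= n IHn a b; rewrite IHn.
  by rewrite !alt_reflect; exact: cox_act_braid.
rewrite word_val_cat word_val1 -xE /letter_val /= ival_ishift va_projK.
rewrite !mulgA mulgVK -k_cent //.
by exists [:: (i, false)]; rewrite ?word_val1.
Qed.

(** The intertwining makes evaluation at [w i] after [l] a multiple [lam i] of evaluation at [i],
    and invariance of the form gives [lam i] the square 1. *)
Lemma cent_ker : va_proj k = 1.
Proof.
have [l X] := cent_reflections; set w := va_proj k in X.
pose lam i : R := (cox_act ind_matrix l (cox_form R ind_matrix i) (ishift w i) / 2)%R.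
have lin i f j : (cox_act ind_matrix l f (ishift w i) * cox_form R ind_matrix (ishift w i) j =
    f i * cox_act ind_matrix l (cox_form R ind_matrix i) j)%R.
  have := congr1 (fun f' : Idx -> R => f' j) (X i f).
  have -> : reflect ind_matrix i f = fun j => (1 * f j + - f i * cox_form R ind_matrix i j)%R.
    by apply/funext => j'; rewrite /reflect; ring.
  by rewrite cox_actD /reflect; lra.
have lamE i f : cox_act ind_matrix l f (ishift w i) = (lam i * f i)%R.
  have := lin i f (ishift w i); rewrite cox_form_diag /lam; lra.
have lam_form i j : cox_act ind_matrix l (cox_form R ind_matrix i) j =
    (lam i * cox_form R ind_matrix (ishift w i) j)%R.
  have := lin i (coord R i) j; rewrite lamE coord_diag; lra.
have lam2 i : (lam i * lam i = 1)%R.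
  have E : cox_act ind_matrix (rev l) (cox_form R ind_matrix (ishift w i)) =
      fun j => (lam i * cox_form R ind_matrix i j + 0 * cox_form R ind_matrix i j)%R.
    rewrite -cox_act_gram; apply/funext => j.
    by rewrite lamE (cox_formC R _ j i); ring.
  have := congr1 (fun f => cox_act ind_matrix l f (ishift w i)) E.
  by rewrite cox_actVK cox_actD lam_form cox_form_diag; lra.
(* If all signs are positive, [l] acts trivially by faithfulness, so [w] fixes every root and is
   1. *)
have [[i lam_neg]|all_pos] := pselect (exists i, lam i < 0)%R; last first.
  have lam1 i : lam i = 1%R.
    have : (0 <= lam i)%R by rewrite leNgt; apply/negP => ?; apply: all_pos; exists i.
    by have := lam2 i; nra.
  have idl (f : Idx -> R) : cox_act ind_matrix l f = f.
    have /(cox_act_eq f) // : cox_eq ind_matrix l [::].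
    apply: (@cox_act_pos_trivial R) => j.
    by rewrite -(ishiftVK w j) lamE lam1 mulr1 ltr01.
  have fix_w i : ishift w i = i.
    have [//|ne] := pselect (ishift w i = i).
    have := lamE i (coord R (ishift w i)); rewrite idl lam1 coord_diag coord_neq //.
    by move/eqP; rewrite mulr0 oner_eq0.
  rewrite -[RHS](@va_lin_trivial w); first by rewrite va_projK.
  move=> f s; have := congr1 (fun i => iroot i f) (fix_w (idx 1 s)).
  by rewrite ishift_idx mulg1 /iroot /= va_lin1.
(* A negative sign at [i] recurs at the opposite root, since both pairs have form value -2. The
   image of the constant function 1 is then negative at both, against [no_infinite_descent]. *)
exfalso; have [u [s iE]] := idxP i; pose i' := idx (u * vtau M s) s.
have Minf : ind_matrix (ishift w i) (ishift w i') = None.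
  by rewrite iE /i' !ishift_idx mulgA; exact: ind_m_opp.
have Minf0 : ind_matrix i i' = None by rewrite iE; exact: ind_m_opp.
have lam_eq : lam i' = lam i.
  have := lam_form i (ishift w i'); rewrite lamE /cox_form Minf Minf0 /=; lra.
have ne : ishift w i <> ishift w i' by move=> E; move: Minf; rewrite E cox_diag.
have := @no_infinite_descent R _ ind_matrix l _ _ ne Minf.
by rewrite !lamE lam_eq; lra.
Qed.

End Centralizer.

(** The commutator of [k] in [D] with an element of the kernel lies in [D] and in the kernel, hence
    is 1. So [k] centralises the kernel and therefore lies in it. *)
Lemma trivial_kernel_trivial (D : G -> Prop) :
  (forall x y, D x -> D y -> D (x * y)) -> (forall x, D x -> D x^-1) ->
  (forall g x, D x -> D (g * x * g^-1)) ->
  (forall x, D x -> va_proj x = 1 -> x = 1) -> forall x, D x -> x = 1.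
Proof.
move=> DM DV DJ ker1 k Dk; apply: (ker1 k) => //; apply: cent_ker => n /gen_ker pn.
have : k * (n * k^-1 * n^-1) = 1.
  apply: ker1; first by apply: DM => //; apply: DJ; exact: DV.
  by rewrite !va_projM !va_projV pn invg1 mul1g mulg1 mulgV.
by rewrite !mulgA => /divg1_eq /(congr1 ( *%g^~ k)); rewrite mulgVK.
Qed.

(** Commuting factors are normal in G, so [H] and [K] meet the kernel in commuting normal subgroups,
    one of which is trivial. That factor is then trivial, and the other one is not proper. *)
Lemma va_indecomposable : coxeter_connected M -> indecomposable G.
Proof.
move=> conn [H [K [[[H1 HD] [h0 nHh0]] [[K1 KD] [k0 nKk0]] [comm HK1 HK]]]].
have HM := group_closedM (conj H1 HD); have HV := group_closedV (conj H1 HD).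
have KM := group_closedM (conj K1 KD); have KV := group_closedV (conj K1 KD).
have HJ g x : x \in H -> g * x * g^-1 \in H.
  move=> Hx; have [h [k [Hh Kk ->]]] := HK g.
  have -> : h * k * x * (h * k)^-1 = h * x * h^-1.
    by rewrite invgM !mulgA -(mulgA h) -(comm x k) // !mulgA mulgK.
  by apply: (HM); [apply: (HM)|exact: HV].
have KJ g x : x \in K -> g * x * g^-1 \in K.
  move=> Kx; have [h [k [Hh Kk ->]]] := HK g.
  have Kc : k * x * k^-1 \in K by apply: (KM); [apply: (KM)|exact: KV].
  have -> : h * k * x * (h * k)^-1 = h * (k * x * k^-1) * h^-1 by rewrite invgM !mulgA.
  by rewrite (comm h (k * x * k^-1)) // mulgK.
pose A x := x \in H /\ va_proj x = 1; pose B x := x \in K /\ va_proj x = 1.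
have projJ g x : va_proj x = 1 -> va_proj (g * x * g^-1) = 1.
  by move=> px; rewrite !va_projM px mulg1 va_projV mulgV.
have nA : va_normal A.
  split=> [x [_ /gen_ker]//|x y [Hx px] [Hy py]|x [Hx px]|g x [Hx px]].
  - by split; [exact: HM|rewrite va_projM px py mulg1].
  - by split; [exact: HV|rewrite va_projV px invg1].
  - by split; [exact: HJ|exact: projJ].
have nB : va_normal B.
  split=> [x [_ /gen_ker]//|x y [Kx px] [Ky py]|x [Kx px]|g x [Kx px]].
  - by split; [exact: KM|rewrite va_projM px py mulg1].
  - by split; [exact: KV|rewrite va_projV px invg1].
  - by split; [exact: KJ|exact: projJ].
have comm' x y : A x -> B y -> x * y = y * x by move=> [Hx _] [Ky _]; exact: comm.
have [A1|B1] := commuting_normal conn nA nB comm'.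
  apply: (negP nKk0); have [h [k [Hh Kk ->]]] := HK k0.
  suff -> : h = 1 by rewrite mul1g.
  apply: (@trivial_kernel_trivial (fun x => x \in H)) => // x Hx px.
  by apply: A1.
apply: (negP nHh0); have [h [k [Hh Kk ->]]] := HK h0.
suff -> : k = 1 by rewrite mulg1.
apply: (@trivial_kernel_trivial (fun x => x \in K)) => // x Kx px.
by apply: B1.
Qed.

End Indecomposable.

Theorem theorem5p6 (S : countType) (Gamma : coxeter_matrix S) :
  coxeter_connected Gamma -> indecomposable (virtual_artin Gamma).
Proof. exact: (@va_indecomposable Rdefinitions.R). Qed.
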